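(* Let $\mathcal X$ and $(\mathcal X_n)_{n\ge0}$ be boundedly-compact pmm spaces. The following are equivalent: (i) $d_{GHP}(\mathcal X_n,\mathcal X)\to0$. (ii) For every $r>0$ and $\epsilon>0$, for all large enough $n$ there exists a compact pmm-subspace $\mathcal X_n'$ of $\mathcal X$ with $\overline B_{r-\epsilon}(\mathcal X)\preceq\mathcal X_n'\preceq\mathcal X$ and $d^c_{GHP}(\overline B_r(\mathcal X_n),\mathcal X_n')<\epsilon$. (iii) For every $r>0$ and $\epsilon>0$, for all large enough $n$ there exist compact pmm-subspaces $\mathcal X'\preceq\mathcal X$ and $\mathcal X_n'\preceq\mathcal X_n$ with $\overline B_r(\mathcal X)\preceq\mathcal X'$, $\overline B_r(\mathcal X_n)\preceq\mathcal X_n'$ and $d^c_{GHP}(\mathcal X',\mathcal X_n')<\epsilon$. (iv) For every continuity radius $r$ of $\mathcal X$, $d^c_{GHP}(\overline B_r(\mathcal X_n),\overline B_r(\mathcal X))\to0$ as $n\to\infty$. (v) There exists an unbounded set $I\subseteq[0,\infty)$ such that for each $r\in I$, $d^c_{GHP}(\overline B_r(\mathcal X_n),\overline B_r(\mathcal X))\to0$ as $n\to\infty$. (vi) $\lim_{n\to\infty}\int_0^\infty e^{-r}\left(1\wedge d^c_{GHP}(\overline B_r(\mathcal X_n),\overline B_r(\mathcal X))\right)dr=0$.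
   Context: A pointed measured metric (pmm) space is $\mathcal X=(X,o,\mu)$ with $X$ a metric space, $o\in X$, $\mu$ a nonnegative Borel measure; compact if $X$ compact and $\mu$ finite; boundedly compact if closed balls $\overline B_r(x)=\{y:d(x,y)\le r\}$ are compact and balls have finite $\mu$-measure. Open ball $B_r(x)=\{y:d(x,y)<r\}$. $\overline B_r(\mathcal X):=(\overline B_r(o),o,\mu|_{\overline B_r(o)})$. A number $r>0$ is a continuity radius of $\mathcal X$ if $\overline B_r(o)$ is the closure of $B_r(o)$ in $X$ and $\mu(\overline B_r(o)\setminus B_r(o))=0$. $d_H$: Hausdorff distance; $d_P$: Prokhorov distance ($d_P(\mu,\nu)=\inf\{\epsilon>0:\mu(A)\le\nu(A^\epsilon)+\epsilon,\ \nu(A)\le\mu(A^\epsilon)+\epsilon\ \forall A\text{ closed}\}$, $A^\epsilon$ closed $\epsilon$-neighborhood). For compact pmm spaces, $d^c_{GHP}(\mathcal X,\mathcal Y)=\inf\{d(f(o_X),g(o_Y))\vee d_H(f(X),g(Y))\vee d_P(f_*\mu_X,g_*\mu_Y)\}$ over metric spaces $Z$ and isometric embeddings $f:X\to Z,g:Y\to Z$. $\mathcal X'=(X',o',\mu')\preceq\mathcal X=(X,o,\mu)$ (pmm-subspace) means $X'\subseteq X$ with the restricted metric, $o'=o$, $\mu'\le\mu$; it is compact if $X'$ is compact and $\mu'$ finite. For boundedly compact $\mathcal X,\mathcal Y$ and $r\ge\epsilon\ge0$: $a(\epsilon,r;\mathcal X,\mathcal Y):=\inf d^c_{GHP}(\overline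 B_r(\mathcal X),\mathcal Y')$ over compact pmm-subspaces $\mathcal Y'$ with $\overline B_{r-\epsilon}(\mathcal Y)\preceq\mathcal Y'\preceq\mathcal Y$; $a_\epsilon:=a(\epsilon,1/\epsilon;\cdot,\cdot)$ for $0<\epsilon\le1$; $d_{GHP}(\mathcal X,\mathcal Y):=\inf\{\epsilon\in(0,1]:a_\epsilon(\mathcal X,\mathcal Y)\vee a_\epsilon(\mathcal Y,\mathcal X)<\epsilon/2\}$, $\inf\emptyset:=1$. *)

(* Defs.v *)
From HB Require Import structures.
From mathcomp Require Import all_boot all_order all_algebra.
From mathcomp Require Import all_classical all_reals all_analysis.
Set Implicit Arguments. Unset Strict Implicit. Unset Printing Implicit Defensive.
Import Order.TTheory GRing.Theory Num.Theory.
Local Open Scope classical_set_scope.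
Local Open Scope ring_scope.

(** Raw data of a pointed measured metric space: carrier, distance, root,
    and a set function (a Borel measure when [is_pmm] holds; only its values
    on Borel sets are ever used). *)
Record pmm (R : realType) := PMM {
  car : Type;
  dist : car -> car -> R;
  pt : car;
  meas : set car -> \bar R }.
Arguments dist {R} p _ _.
Arguments meas {R} p _.
Arguments pt {R} p.
Arguments car {R} p.

Definition is_metric (R : realType) (T : Type) (d : T -> T -> R) : Prop :=
  (forall x y, d x y = 0 <-> x = y) /\ (forall x y, d x y = d y x) /\
  (forall x y z, d x z <= d x y + d y z).

Definition mopen (R : realType) (T : Type) (d : T -> T -> R) (A : set T) : Prop :=
  forall x, A x -> exists2 e, 0 < e & [set y | d x y < e] `<=` A.
Definition mclosed (R : realType) (T : Type) (d : T -> T -> R) (A : set T) : Prop :=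
  mopen d (~` A).
Definition mborel (R : realType) (T : Type) (d : T -> T -> R) : set (set T) :=
  <<s [set A | mopen d A] >>.
Definition mcompact (R : realType) (T : Type) (d : T -> T -> R) (A : set T) : Prop :=
  forall F : set (set T), (forall U, F U -> mopen d U) ->
    A `<=` \bigcup_(U in F) U ->
    exists (n : nat) (G : nat -> set T), (forall i, (i < n)%N -> F (G i)) /\
      A `<=` \bigcup_(i in [set i | (i < n)%N]) G i.

Definition is_measure (R : realType) (T : Type) (d : T -> T -> R)
    (mu : set T -> \bar R) : Prop :=
  mu set0 = 0%E /\ (forall A, mborel d A -> (0 <= mu A)%E) /\
  (forall F : nat -> set T, (forall n, mborel d (F n)) -> trivIset setT F ->
     (fun n => (\sum_(0 <= i < n) mu (F i))%E) @ \oo --> mu (\bigcup_n F n)).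

Definition is_pmm (R : realType) (X : pmm R) : Prop :=
  is_metric (dist X) /\ is_measure (dist X) (meas X).

Definition cballc (R : realType) (X : pmm R) (x : car X) (r : R) : set (car X) :=
  [set y | dist X x y <= r].
Definition oballc (R : realType) (X : pmm R) (x : car X) (r : R) : set (car X) :=
  [set y | dist X x y < r].

Definition bcompact (R : realType) (X : pmm R) : Prop :=
  (forall x r, mcompact (dist X) (@cballc R X x r)) /\
  (forall x r, (meas X (@oballc R X x r) < +oo)%E).

Definition compact_pmm (R : realType) (X : pmm R) : Prop :=
  mcompact (dist X) setT /\ (meas X setT < +oo)%E.

(** closed epsilon-neighbourhood {z | d(z,A) <= e} *)
Definition mnbhd (R : realType) (T : Type) (d : T -> T -> R) (A : set T) (e : R) : set T :=
  [set z | forall delta, 0 < delta -> exists2 a, A a & d z a < e + delta].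

Definition hausdorff (R : realType) (T : Type) (d : T -> T -> R) (A B : set T) : \bar R :=
  ereal_inf [set e%:E | e in [set e : R | 0 < e /\
     A `<=` mnbhd d B e /\ B `<=` mnbhd d A e]].

Definition prokhorov (R : realType) (T : Type) (d : T -> T -> R)
    (mu nu : set T -> \bar R) : \bar R :=
  ereal_inf [set e%:E | e in [set e : R | 0 < e /\
     forall A, mclosed d A ->
       (mu A <= nu (mnbhd d A e) + e%:E)%E /\ (nu A <= mu (mnbhd d A e) + e%:E)%E]].

Definition isometric (R : realType) (T U : Type) (dT : T -> T -> R) (dU : U -> U -> R)
    (f : T -> U) : Prop := forall x y, dU (f x) (f y) = dT x y.

Definition dGHPc (R : realType) (X Y : pmm R) : \bar R :=
  ereal_inf [set v | exists (Z : Type) (dZ : Z -> Z -> R)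
      (f : car X -> Z) (g : car Y -> Z),
    [/\ is_metric dZ, isometric (dist X) dZ f, isometric (dist Y) dZ g &
      v = maxe (maxe (dZ (f (pt X)) (g (pt Y)))%:E (hausdorff dZ (range f) (range g)))
               (prokhorov dZ (fun A => meas X (f @^-1` A)) (fun A => meas Y (g @^-1` A)))]].

Definition incl (T : Type) (S : set T) (a : {x | S x}) : T := proj1_sig a.

Definition sub_pmm (R : realType) (X : pmm R) (S : set (car X)) (hS : S (pt X))
    (nu : set {x | S x} -> \bar R) : pmm R :=
  @PMM R {x | S x} (fun a b => dist X (proj1_sig a) (proj1_sig b))
    (exist _ (pt X) hS) nu.

Definition is_subpmm (R : realType) (X : pmm R) (S : set (car X))
    (nu : set {x | S x} -> \bar R) : Prop :=
  is_measure (fun a b : {x | S x} => dist X (proj1_sig a) (proj1_sig b)) nu /\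
  forall A, mborel (dist X) A -> (nu (@incl _ S @^-1` A) <= meas X A)%E.
Arguments is_subpmm {R} X S nu.

Definition cball (R : realType) (X : pmm R) (s : R) : set (car X) := @cballc R X (pt X) s.
Arguments cball {R} X s _.

Definition ball_le (R : realType) (X : pmm R) (s : R) (S : set (car X))
    (nu : set {x | S x} -> \bar R) : Prop :=
  cball X s `<=` S /\
  forall A, mborel (dist X) A -> (meas X (A `&` cball X s) <= nu (@incl _ S @^-1` A))%E.
Arguments ball_le {R} X s S nu.

(** carrier of \bar B_r(X); for r >= 0 (the only case used) this is the closed
    ball {y | d(o,y) <= r}, the disjunct y = o only supplies the root proof. *)
Definition ballset (R : realType) (X : pmm R) (r : R) : set (car X) :=
  [set y | y = pt X \/ dist X (pt X) y <= r].
Arguments ballset {R} X r _.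

Definition ballpmm (R : realType) (X : pmm R) (r : R) : pmm R :=
  @sub_pmm R X (ballset X r) (or_introl erefl) (fun A => meas X (@incl _ (ballset X r) @` A)).
Arguments ballpmm {R} X r.

Definition acoef (R : realType) (eps r : R) (X Y : pmm R) : \bar R :=
  ereal_inf [set v | exists (S : set (car Y)) (hS : S (pt Y)) (nu : set {y | S y} -> \bar R),
    [/\ is_subpmm Y S nu, compact_pmm (sub_pmm hS nu), ball_le Y (r - eps) S nu &
        v = dGHPc (ballpmm X r) (sub_pmm hS nu)]].

Definition aeps (R : realType) (eps : R) (X Y : pmm R) : \bar R := acoef eps eps^-1 X Y.

(** d_GHP, with inf of the empty set := 1 *)
Definition dGHP (R : realType) (X Y : pmm R) : \bar R :=
  ereal_inf ([set e%:E | e in [set e : R | 0 < e <= 1 /\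
      (maxe (aeps e X Y) (aeps e Y X) < (e / 2)%:E)%E]] `|` [set 1%E]).

Definition continuity_radius (R : realType) (X : pmm R) (r : R) : Prop :=
  [/\ 0 < r,
      (forall y, dist X (pt X) y <= r <->
         forall e, 0 < e -> exists2 z, dist X (pt X) z < r & dist X y z < e) &
      meas X (cball X r `\` @oballc R X (pt X) r) = 0%E].

(* Main.v *)
Require Import Defs.
From HB Require Import structures.
From mathcomp Require Import all_boot all_order all_algebra.
From mathcomp Require Import all_classical all_reals all_analysis.
From mathcomp Require Import measurable_realfun lra.
Import Order.TTheory GRing.Theory Num.Theory.
Set Implicit Arguments. Unset Strict Implicit. Unset Printing Implicit Defensive.
Local Open Scope classical_set_scope.
Local Open Scope ring_scope.

(** All implications go through (iii).  That (i), (ii), (v) or (vi) implies (iii)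
    is immediate: the subspaces provided, or balls of a suitable radius, are the
    required ones; for (vi), otherwise the integrand would be bounded below on
    [[r, r + 1]].

    (iii) => (iv): in the space [Z] realizing the closeness of the subspaces, the
    balls of radius [r] are close as well, since for a continuity radius the mass
    of a thin annulus at distance [r] is small and, by compactness, the balls of
    radii close to [r] are Hausdorff-close to each other.

    (iv) => (i), (v), (vi): all but countably many radii are continuity radii.
    Choosing [1/e] among them gives (i), with balls as subspaces; dominated
    convergence gives (vi).  No measurability in [r] is needed for (vi), because
    the integral of a nonnegative function is a supremum over simple functions.

    (iii) => (ii): the ball of [Xs n] may contain an arbitrary part of the mass
    that [X] has on the sphere of radius [r], so a submeasure of [meas X] has to
    be constructed.  Instead of Strassen's theorem, a finite partition of [X] into
    small cells with negligible boundary is used, and [meas X] is rescaled on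
    each cell to the mass that the ball of [Xs n] has in the same cell of [Z]. *)

Local Notation inc S := (@Defs.incl _ S).

(** * Metric spaces and their Borel sets *)

Section Metric.
Context (R : realType) (T : Type) (d : T -> T -> R).
Hypothesis dM : is_metric d.

Lemma ismetric_xx x : d x x = 0.
Proof. by case: dM => h _; apply/h. Qed.

Lemma ismetric_sym x y : d x y = d y x.
Proof. by case: dM => _ [h _]; exact: h. Qed.

Lemma ismetric_tri y x z : d x z <= d x y + d y z.
Proof. by case: dM => _ [_ h]; exact: h. Qed.

Lemma ismetric_ge0 x y : 0 <= d x y.
Proof. have := ismetric_tri y x x; rewrite ismetric_xx (ismetric_sym y x); lra. Qed.

Lemma mopen_oball c r : mopen d [set y | d c y < r].
Proof.
move=> x /= cx; exists (r - d c x); first lra.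
move=> y /= xy; have := ismetric_tri x c y; lra.
Qed.

Lemma mopen_gt c r : mopen d [set y | r < d c y].
Proof.
move=> x /= cx; exists (d c x - r); first lra.
move=> y /= xy; have := ismetric_tri y c x; rewrite (ismetric_sym y x); lra.
Qed.

Lemma mclosed_cball c r : mclosed d [set y | d c y <= r].
Proof.
have := @mopen_gt c r; rewrite /mclosed; congr mopen.
by apply/seteqP; split=> x /=; rewrite ltNge => /negP.
Qed.

Lemma mclosed_ge c r : mclosed d [set y | r <= d c y].
Proof.
have := @mopen_oball c r; rewrite /mclosed; congr mopen.
by apply/seteqP; split=> x /=; rewrite ltNge => /negP.
Qed.

Lemma mopenI A B : mopen d A -> mopen d B -> mopen d (A `&` B).
Proof.
move=> hA hB x [/hA[e e0 he] /hB[e' e'0 he']].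
exists (Num.min e e'); first by rewrite lt_min e0.
move=> y /=; rewrite lt_min => /andP[h1 h2].
by split; [exact: he|exact: he'].
Qed.

Lemma mopenU A B : mopen d A -> mopen d B -> mopen d (A `|` B).
Proof.
by move=> hA hB x [/hA|/hB] [e e0 he]; exists e => // y /he ?; [left|right].
Qed.

Lemma mclosedI A B : mclosed d A -> mclosed d B -> mclosed d (A `&` B).
Proof. by move=> hA hB; rewrite /mclosed setCI; exact: mopenU. Qed.

Lemma mclosedU A B : mclosed d A -> mclosed d B -> mclosed d (A `|` B).
Proof. by move=> hA hB; rewrite /mclosed setCU; exact: mopenI. Qed.

Lemma mclosed_set0 : mclosed d set0.
Proof. by move=> x _; exists 1; [exact: ltr01|move=> y _]. Qed.

Lemma mclosed_bigcap (I : Type) (P : I -> Prop) (A : I -> set T) :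
  (forall i, P i -> mclosed d (A i)) -> mclosed d [set x | forall i, P i -> A i x].
Proof.
move=> hA x /= /existsNP[i /not_implyP[Pi nA]].
have [e e0 he] := hA i Pi x nA.
by exists e => // y /he ny h; apply: ny; exact: h.
Qed.

Lemma mclosed_bigcup_seq (I : eqType) (s : seq I) (A : I -> set T) :
  (forall i, mclosed d (A i)) ->
  mclosed d [set x | exists2 i, i \in s & A i x].
Proof.
move=> hA; elim: s => [|i s ih].
  have := mclosed_set0; congr mclosed.
  by apply/seteqP; split => // x /= [].
have := mclosedU (hA i) ih; congr mclosed.
apply/seteqP; split => x /=.
  by move=> [h|[j js h]]; [exists i; rewrite ?mem_head|exists j => //; rewrite inE js orbT].
move=> [j]; rewrite inE => /orP[/eqP->|js h]; first by left.
by right; exists j.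
Qed.

Lemma mnbhd_le A B e e' : A `<=` B -> e <= e' -> mnbhd d A e `<=` mnbhd d B e'.
Proof.
by move=> AB ee' z h dl dl0; have [a Aa za] := h _ dl0; exists a; [exact: AB|lra].
Qed.

Lemma in_mnbhd (A : set T) e z a : A a -> d z a <= e -> mnbhd d A e z.
Proof. by move=> Aa h dl dl0; exists a => //; lra. Qed.

Lemma mclosed_mnbhd A e : mclosed d (mnbhd d A e).
Proof.
move=> z /= /existsNP[dl /not_implyP[dl0 h]].
exists (dl / 2); first lra.
move=> y /= zy hy; apply: h.
have [|a Aa ya] := hy (dl / 2); first lra.
by exists a => //; have := ismetric_tri y z a; lra.
Qed.

Lemma mnbhd_dist_le (A : set T) c t e z :
  A `<=` [set x | d c x <= t] -> mnbhd d A e z -> d c z <= t + e.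
Proof.
move=> h hz; apply/ler_addgt0Pr => dl dl0.
have [a /h /= ca za] := hz _ dl0.
have := ismetric_tri a c z; rewrite (ismetric_sym a z); lra.
Qed.

Lemma mnbhd_dist_ge (A : set T) c t e z :
  A `<=` [set x | t <= d c x] -> mnbhd d A e z -> t - e <= d c z.
Proof.
move=> h hz; rewrite lerBlDr; apply/ler_addgt0Pr => dl dl0.
have [a /h /= ca za] := hz _ dl0.
have := ismetric_tri z c a; lra.
Qed.

Lemma mborel_open A : mopen d A -> mborel d A.
Proof. by move=> h; apply: sub_gen_smallest. Qed.

Lemma mborel_sigma : sigma_algebra setT (mborel d).
Proof. exact: smallest_sigma_algebra. Qed.

Lemma mborelC A : mborel d A -> mborel d (~` A).
Proof. by case: mborel_sigma => _ h _ /h; rewrite setTD. Qed.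

Lemma mborel_closed A : mclosed d A -> mborel d A.
Proof. by move=> /mborel_open/mborelC; rewrite setCK. Qed.

Lemma mborel_bigcup (F : nat -> set T) :
  (forall n, mborel d (F n)) -> mborel d (\bigcup_n F n).
Proof. by case: mborel_sigma => _ _; apply. Qed.

Lemma mborel0 : mborel d set0.
Proof. by case: mborel_sigma. Qed.

Lemma mborelT : mborel d setT.
Proof. by have := mborelC mborel0; rewrite setC0. Qed.

Lemma mborelU A B : mborel d A -> mborel d B -> mborel d (A `|` B).
Proof.
move=> hA hB; rewrite -bigcup2E; apply: mborel_bigcup => -[|[|n]] //=.
exact: mborel0.
Qed.

Lemma mborelI A B : mborel d A -> mborel d B -> mborel d (A `&` B).
Proof.
by move=> /mborelC hA /mborelC hB; have := mborelC (mborelU hA hB); rewrite setCU !setCK.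
Qed.

Lemma mborelD A B : mborel d A -> mborel d B -> mborel d (A `\` B).
Proof. by move=> hA hB; rewrite setDE; apply: mborelI => //; exact: mborelC. Qed.

Lemma mborel_bigcap_seq (I : eqType) (s : seq I) (A : I -> set T) :
  (forall i, mborel d (A i)) -> mborel d [set x | forall i, i \in s -> A i x].
Proof.
move=> hA; elim: s => [|i s ih].
  by have := mborelT; congr mborel; apply/seteqP; split.
have := mborelI (hA i) ih; congr mborel.
apply/seteqP; split => x /=.
  by move=> [h1 h2] j; rewrite inE => /orP[/eqP->//|]; exact: h2.
move=> h; split; first by apply: h; rewrite mem_head.
by move=> j js; apply: h; rewrite inE js orbT.
Qed.

(** A finite intersection: for each [i], the set [A i] or its complement, according to whether [i]
    is in [J]. The cells of the later partition have this form. *)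
Lemma mborel_signature (I : finType) (A : I -> T -> bool) (J : {set I}) :
  (forall i, mborel d [set x | A i x]) ->
  mborel d [set x | [set i | A i x]%SET = J].
Proof.
move=> hA.
have /= := @mborel_bigcap_seq I (enum I) (fun i => [set x | A i x = (i \in J)]).
have h : forall i, mborel d [set x | A i x = (i \in J)].
  move=> i; case: (i \in J); first exact: hA.
  have := mborelC (hA i); congr mborel.
  by apply/seteqP; split => x /=; case: (A i x) => // h; case: h.
move=> /(_ h); congr mborel.
apply/seteqP; split => x /=.
  by move=> hx; apply/setP => i; rewrite inE hx// mem_enum.
by move=> <- i _; rewrite inE.
Qed.

End Metric.
Arguments mopen_oball {R T d} dM c r.
Arguments mopen_gt {R T d} dM c r.
Arguments mclosed_cball {R T d} dM c r.
Arguments mclosed_ge {R T d} dM c r.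
Arguments mclosed_mnbhd {R T d} dM A e.

Lemma mborel_preimage (R : realType) (T U : Type) (dT : T -> T -> R)
    (dU : U -> U -> R) (f : T -> U) :
  (forall A, mopen dU A -> mopen dT (f @^-1` A)) ->
  forall A, mborel dU A -> mborel dT (f @^-1` A).
Proof.
move=> hf; apply: smallest_sub; last by move=> A /hf; exact: mborel_open.
split=> /=.
- by rewrite preimage_set0; exact: mborel0.
- by move=> A /= hA; rewrite setTD preimage_setC; exact: mborelC.
- by move=> F /= hF; rewrite preimage_bigcup; exact: mborel_bigcup.
Qed.

Lemma isometric_open (R : realType) (T U : Type) (dT : T -> T -> R)
    (dU : U -> U -> R) (f : T -> U) A :
  isometric dT dU f -> mopen dU A -> mopen dT (f @^-1` A).
Proof.
move=> hf hA x /= /hA[e e0 he]; exists e => // y /= xy; apply: he => /=.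
by rewrite hf.
Qed.

Lemma isometric_closed (R : realType) (T U : Type) (dT : T -> T -> R)
    (dU : U -> U -> R) (f : T -> U) A :
  isometric dT dU f -> mclosed dU A -> mclosed dT (f @^-1` A).
Proof. by move=> hf hA; rewrite /mclosed preimage_setC; exact: isometric_open hf hA. Qed.

(** * Borel sets and compactness in a subset with the restricted metric *)

Section Subspace.
Context (R : realType) (T : Type) (d : T -> T -> R) (S : set T).
Hypothesis dM : is_metric d.
Let dS := fun a b : {x | S x} => d (proj1_sig a) (proj1_sig b).

Lemma incl_inj : injective (inc S).
Proof. by move=> [x hx] [y hy] /= e; subst y; congr exist; exact: Prop_irrelevance. Qed.

Lemma image_incl_preimage (A : set T) : inc S @` (inc S @^-1` A) = A `&` S.
Proof.
apply/seteqP; split => x /=.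
  by move=> [[y hy] /= Ay <-].
by move=> [Ax Sx]; exists (exist _ x Sx).
Qed.

Lemma incl_isometric : isometric dS d (inc S).
Proof. by []. Qed.

Lemma mborel_incl A : mborel d A -> mborel dS (inc S @^-1` A).
Proof. by apply: mborel_preimage => B; exact: isometric_open incl_isometric. Qed.

(** The sets with Borel image form a sigma-algebra because [S] is closed, hence Borel; it contains
    the open sets, since these are traces on [S] of open sets of [T]. *)
Lemma mborel_image_incl A : mclosed d S -> mborel dS A -> mborel d (inc S @` A).
Proof.
move=> Scl; have bS : mborel d S by exact: mborel_closed.
move: A; apply: smallest_sub.
  split=> /=.
  - by rewrite image_set0; exact: mborel0.
  - move=> A /= hA; rewrite setTD.
    have := mborelD bS hA; congr mborel; apply/seteqP; split=> x /=.
      by move=> [Sx h]; exists (exist _ x Sx) => // Ax; apply: h; exists (exist _ x Sx).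
    move=> [[y hy] /= nA <-]; split => // -[u Au /= uy]; apply: nA.
    by rewrite (_ : exist _ y hy = u) //; apply: incl_inj.
  - by move=> F hF /=; rewrite image_bigcup; exact: mborel_bigcup.
move=> A hA /=.
(* The union of the balls of [T] centred in [A] whose trace on [S] lies in [A]. *)
pose V := [set y | exists2 u, A u & exists2 e, 0 < e &
  [set v | dS u v < e] `<=` A /\ d (inc S u) y < e].
have := mborelI (A := V) _ bS; rewrite -image_incl_preimage => h.
have -> : A = inc S @^-1` V.
  apply/seteqP; split => u /=.
    move=> Au; have [e e0 he] := hA _ Au; exists u => //; exists e => //; split => //.
    by rewrite ismetric_xx.
  by move=> [v Av [e e0 [he uv]]]; apply: he.
apply: h; apply: mborel_open => y [u Au [e e0 [he uy]]].
have [r r0 hr] := mopen_oball dM (inc S u) e y uy.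
by exists r => // z /hr /= uz; exists u => //; exists e.
Qed.

Lemma mcompact_sub : mcompact d S -> mcompact dS setT.
Proof.
move=> hS F Fo Fcov.
pose F' := [set V | mopen d V /\ exists2 U, F U & inc S @^-1` V `<=` U].
have [||n [G [hG1 hG2]]] := hS F'; first by move=> V [].
  move=> x Sx; have [//|U FU Ux] := Fcov (exist _ x Sx).
  have [e e0 he] := Fo U FU _ Ux.
  exists [set y | d x y < e]; last by rewrite /= ismetric_xx.
  by split; [exact: mopen_oball|exists U].
have /choice[H hH] : forall i, exists U, (i < n)%N -> F U /\ inc S @^-1` (G i) `<=` U.
  move=> i; case: (boolP (i < n)%N) => [lt|_]; last by exists set0.
  by have [_ [U FU h]] := hG1 _ lt; exists U.
exists n, H; split; first by move=> i /hH[].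
move=> [x Sx] _; have [i /= lt Gx] := hG2 _ Sx.
by exists i => //; have [_] := hH _ lt; apply.
Qed.

End Subspace.

(** * Borel measures *)

Section Measure.
Context (R : realType) (T : Type) (d : T -> T -> R) (mu : set T -> \bar R).
Hypothesis dM : is_metric d.
Hypothesis muM : is_measure d mu.

Lemma meas0 : mu set0 = 0%E.
Proof. by case: muM. Qed.

Lemma meas_ge0 A : mborel d A -> (0 <= mu A)%E.
Proof. by case: muM => _ [+ _]; apply. Qed.

Lemma measU A B : mborel d A -> mborel d B -> A `&` B = set0 ->
  mu (A `|` B) = (mu A + mu B)%E.
Proof.
case: muM => m0 [_ madd] hA hB AB.
have hF n : mborel d (bigcup2 A B n).
  by case: n => [|[|n]] //=; exact: mborel0.
have := madd _ hF; rewrite -trivIset_bigcup2 => /(_ AB); rewrite bigcup2E => h.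
apply: (cvg_unique _ h) => //.
(* The sequence is [A], [B], then empty sets, so the partial sums are constant from index 2 on. *)
apply: cvg_near_cst; exists 2%N => // n /= n2.
rewrite -(subnKC n2) big_nat_recl// big_nat_recl//= big1 ?adde0//.
Qed.

Lemma le_meas A B : mborel d A -> mborel d B -> A `<=` B -> (mu A <= mu B)%E.
Proof.
move=> hA hB AB.
have -> : B = A `|` (B `\` A) by rewrite setDUK.
rewrite measU//; last by rewrite setIC setDKI.
  by rewrite leeDl// meas_ge0//; exact: mborelD.
exact: mborelD.
Qed.

Lemma meas_subU A B C : mborel d A -> mborel d B -> mborel d C ->
  A `<=` B `|` C -> (mu A <= mu B + mu C)%E.
Proof.
move=> hA hB hC ABC.
have hD := mborelD hC hB.
apply: (@le_trans _ _ (mu (B `|` (C `\` B)))).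
  apply: le_meas => //; first exact: mborelU.
  by move=> x /ABC[|Cx]; [left|have [|] := pselect (B x); [left|right]].
rewrite measU//; last by rewrite setIC setDKI.
by rewrite leeD2l// le_meas//; exact: subDsetl.
Qed.

Lemma mborel_in_seq (J : eqType) (s : T -> J) (r : seq J) :
  (forall j, mborel d [set x | s x = j]) -> mborel d [set x | s x \in r].
Proof.
move=> hs; elim: r => [|j q ih].
  by rewrite (_ : [set _ | _] = set0); [exact: mborel0|apply/seteqP; split].
have := mborelU (hs j) ih; congr mborel.
apply/seteqP; split => x /=; rewrite inE.
  by move=> [->|->]; rewrite ?eqxx ?orbT.
by move=> /orP[/eqP|]; [left|right].
Qed.

(** Applied with [s] the distance to a point, for disjoint spheres, and with [s] the signature of a
    point, for cells. *)
Lemma meas_fibers (J : eqType) (s : T -> J) (r : seq J) A :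
  mborel d A -> (forall j, mborel d [set x | s x = j]) -> uniq r ->
  (\sum_(j <- r) mu (A `&` [set x | s x = j]))%E = mu (A `&` [set x | s x \in r]).
Proof.
move=> hA hs.
have hr q := mborel_in_seq q hs.
elim: r => [_|j r ih /= /andP[jr ur]].
  by rewrite big_nil (_ : _ `&` _ = set0) ?meas0//; apply/seteqP; split => // x [].
rewrite big_cons ih// -measU; last 3 first.
- exact: mborelI.
- exact: mborelI.
- by apply/seteqP; split => // x /= [[_ ->] [_]]; rewrite (negbTE jr).
congr mu; apply/seteqP; split => x /=; rewrite inE.
  by move=> [[Ax ->]|[Ax ->]]; rewrite ?eqxx ?orbT.
by move=> [Ax /orP[/eqP|]]; [left|right].
Qed.

Lemma meas_fibers_cond (J : finType) (s : T -> J) (P : pred J) A :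
  mborel d A -> (forall j, mborel d [set x | s x = j]) ->
  (\sum_(j | P j) mu (A `&` [set x | s x = j]))%E = mu (A `&` [set x | P (s x)]).
Proof.
move=> hA hs; rewrite -big_filter meas_fibers ?filter_uniq ?index_enum_uniq//.
by congr (mu (_ `&` _)); apply/seteqP; split=> x /=;
  rewrite mem_filter mem_index_enum andbT.
Qed.

(** Continuity from above, obtained from countable additivity on the differences [E n]: their
    partial sums tend to [mu (F 0)], and what is missing at stage [n] is [mu (F n)]. *)
Lemma meas_decreasing_small (F : nat -> set T) (eta : R) :
  (forall n, mborel d (F n)) -> (forall n, F n.+1 `<=` F n) ->
  (mu (F 0%N) < +oo)%E -> mu (\bigcap_n F n) = 0%E -> 0 < eta ->
  exists n, (mu (F n) <= eta%:E)%E.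
Proof.
move=> hF dF F0 F00 eta0.
have dF' m n : (m <= n)%N -> F n `<=` F m.
  move=> /subnKC <-; elim: (n - m)%N => [|k ih]; first by rewrite addn0.
  by rewrite addnS => x /dF /ih.
pose E n := F n `\` F n.+1.
have hE n : mborel d (E n) by exact: mborelD.
have fin n : mu (F n) \is a fin_num.
  rewrite ge0_fin_numE ?meas_ge0// (le_lt_trans _ F0)//.
  by apply: le_meas => //; exact: dF'.
have tE : trivIset setT E.
  apply: ltn_trivIset => n1 n2 lt; apply/seteqP; split => // x [[_ h] [h' _]].
  by apply: h; exact: dF' h'.
have part n : (\sum_(0 <= i < n) mu (E i) + mu (F n) = mu (F 0%N))%E.
  elim: n => [|n ih]; first by rewrite big_nil add0e.
  rewrite big_nat_recr//= -addeA -measU//; last first.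
    by apply/seteqP; split => // x [[_ h] ?].
  rewrite /E setUC setDUK//.
case: muM => _ [_ /(_ _ hE tE)].
have -> : mu (\bigcup_n E n) = mu (F 0%N).
  have bC : mborel d (\bigcap_n F n).
    rewrite -[\bigcap_n F n]setCK setC_bigcap; apply: mborelC.
    by apply: mborel_bigcup => n; exact: mborelC.
  have -> : F 0%N = (\bigcup_n E n) `|` (\bigcap_n F n).
    apply/seteqP; split => x; last first.
      by move=> [[n _ [/(dF' 0%N) h _]]|/(_ 0%N Logic.I)//]; exact: h.
    move=> F0x; case: (pselect ((\bigcap_n F n) x)) => [|h]; first by right.
    have ex : exists n, ~~ `[< F n x >].
      have /existsNP[n hn] := h; exists n; apply/asboolPn => Fn; exact: hn.
    (* The point leaves the sequence at a least index, which is not 0, and so lies in the difference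
       just before. *)
    left; have [m Fm hm] := ex_minnP ex.
    case: m Fm hm => [/asboolPn //|m Fm hm].
    exists m => //; split; last by move/asboolPn : Fm.
    apply: contrapT => nF; have /hm : ~~ `[< F m x >] by exact/asboolPn.
    by rewrite ltnn.
  rewrite measU ?F00 ?adde0//; first exact: mborel_bigcup.
  apply/seteqP; split => // x [[n _ [_ h]] h']; apply: h; exact: h'.
move=> cv.
have : ((mu (F 0%N) - eta%:E)%E < mu (F 0%N))%E.
  by rewrite lteBlDr ?fin// lteDl ?lte_fin.
move=> /(conj (@open_ereal_gt_ereal R (mu (F 0%N) - eta%:E)%E))/open_nbhs_nbhs/cv.
move=> [N _ /(_ N (leqnn N)) /= h].
exists N; rewrite -(part N) in h.
have finE : \sum_(0 <= i < N) mu (E i) \is a fin_num.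
  by have := fin 0%N; rewrite -(part N) fin_numD => /andP[].
move: h; rewrite EFinN lteBlDr// lteD2lE// => /ltW //.
Qed.

Lemma mborel_sphere c r : mborel d [set x | d c x = r].
Proof.
have := mborelI (mborel_closed (mclosed_cball dM c r)) (mborel_closed (mclosed_ge dM c r)).
congr mborel; apply/seteqP; split => x /=; last by move=> ->.
by move=> [h1 h2]; apply/eqP; rewrite eq_le h1.
Qed.

Lemma mborel_cball c r : mborel d [set x | d c x <= r].
Proof. exact: mborel_closed (mclosed_cball dM c r). Qed.

Lemma mclosed_annulus c r e : mclosed d [set x | `|d c x - r| <= e].
Proof.
have := mclosedI (mclosed_cball dM c (r + e)) (mclosed_ge dM c (r - e)).
congr mclosed; apply/seteqP; split => x /=; rewrite ler_distl.
  by move=> [-> ->].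
by move=> /andP[].
Qed.

Hypothesis muf : forall c r, (mu [set x | (d c x < r)%R] < +oo)%E.

Lemma meas_cball_fin c r : (mu [set x | (d c x <= r)%R] < +oo)%E.
Proof.
rewrite (le_lt_trans _ (muf c (r + 1)))//; apply: le_meas.
- exact: mborel_cball.
- exact: mborel_open (mopen_oball dM _ _).
- by move=> x /=; lra.
Qed.

Lemma meas_sub_cball_fin A c r : mborel d A -> A `<=` [set x | d c x <= r] ->
  mu A \is a fin_num.
Proof.
move=> hA Ac; rewrite ge0_fin_numE ?meas_ge0//.
by rewrite (le_lt_trans _ (meas_cball_fin c r))// le_meas//; exact: mborel_cball.
Qed.

(** The annuli of half-width [1/(n+1)] decrease to the sphere, which is null. *)
Lemma meas_annulus_small c r eta : mu [set x | d c x = r] = 0%E -> 0 < eta ->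
  exists2 e, 0 < e & (mu [set x | (`|d c x - r| <= e)%R] <= eta%:E)%E.
Proof.
move=> h eta0.
have [||||n hn] := @meas_decreasing_small
    (fun n => [set x | `|d c x - r| <= n.+1%:R^-1]) eta _ _ _ _ eta0.
- by move=> n; exact: mborel_closed (@mclosed_annulus _ _ _).
- by move=> n x /= /le_trans; apply; rewrite lef_pV2 ?posrE// ler_nat.
- apply: (le_lt_trans _ (meas_cball_fin c (r + 1))); apply: le_meas.
  + exact: mborel_closed (@mclosed_annulus _ _ _).
  + exact: mborel_cball.
  + by move=> x /=; rewrite invr1 ler_distl; lra.
- rewrite -h; congr mu; apply/seteqP; split => x /=; last first.
    by move=> dx n _ /=; rewrite dx subrr normr0 invr_ge0.
  move=> hx; apply/eqP; rewrite -subr_eq0 -normr_le0; apply/ler_addgt0Pr => e e0.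
  rewrite add0r; have := near_infty_natSinv_lt (PosNum e0) => -[n _ /(_ n (leqnn n)) /=].
  by move=> /ltW; apply: le_trans; exact: hx.
by exists n.+1%:R^-1 => //; rewrite invr_gt0.
Qed.

Lemma meas_annuli_small (k : nat) (x : nat -> T) r eta :
  (forall i, (i < k)%N -> mu [set y | d (x i) y = r] = 0%E) -> 0 < eta ->
  exists2 e, 0 < e &
    (mu [set y | (exists2 i, (i \in iota 0 k) & `|d (x i) y - r| <= e)%R] <= eta%:E)%E.
Proof.
elim: k eta => [|k ih] eta h eta0.
  exists 1 => //; rewrite (_ : [set _ | _] = set0) ?meas0 ?lee_fin ?ltW//.
  by apply/seteqP; split => // y [].
have eta2 : 0 < eta / 2 by lra.
have [|e1 e10 h1] := ih (eta / 2) _ eta2; first by move=> i ik; apply: h; rewrite ltnS ltnW.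
have [e2 e20 h2] := meas_annulus_small (h k (ltnSn k)) eta2.
exists (Num.min e1 e2); first by rewrite lt_min e10.
have bS q e : mborel d [set y | exists2 i, i \in iota 0 q & `|d (x i) y - r| <= e].
  by apply: mborel_closed; apply: mclosed_bigcup_seq => i; exact: mclosed_annulus.
rewrite (splitr eta) EFinD (le_trans _ (leeD h1 h2))//; apply: meas_subU => //.
  exact: mborel_closed (@mclosed_annulus _ _ _).
move=> y [i]; rewrite mem_iota add0n ltnS (leq_eqVlt i) le_min => /andP[_ /orP[/eqP->|ik]] /andP[? ?].
  by right.
by left; exists i => //; rewrite mem_iota.
Qed.

(** Spheres of different radii are disjoint, so a ball of finite mass holds only finitely many of
    mass at least [1/(k+1)]. The heavy radii are a countable union of such finite sets. *)
Lemma countable_heavy_spheres c :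
  countable [set r | mu [set x | d c x = r] != 0%E].
Proof.
pose P (nk : nat * nat) := [set r : R | r <= nk.1%:R /\
  ((nk.2.+1%:R^-1)%:E <= mu [set x | d c x = r])%E].
apply: (@sub_countable _ _ _ (\bigcup_(nk in setT) P nk)).
  apply: subset_card_le => r /= mr.
  have m0 : (0 < mu [set x | d c x = r])%E.
    by rewrite lt_neqAle eq_sym mr meas_ge0//; exact: mborel_sphere.
  have [k hk] : exists k : nat, ((k.+1%:R^-1)%:E <= mu [set x | (d c x = r)%R])%E.
    case: (mu _) m0 => [q| |]//; last by exists 0%N; rewrite leey.
    rewrite lte_fin => q0.
    have := near_infty_natSinv_lt (PosNum q0) => -[n _ /(_ n (leqnn n)) /= h].
    by exists n; rewrite lee_fin ltW.
  exists ((Num.truncn `|r|%R).+1, k) => //; split => //=.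
  by rewrite (le_trans (ler_norm r))// ltW// truncnS_gt.
apply: bigcup_countable => // -[n k] _; apply: finite_set_countable.
apply: contrapT => /infinite_set_fsetP inf.
have fin := meas_cball_fin c n%:R.
(* [M] spheres of mass at least [1/(k+1)] would outweigh the ball of radius [n]. *)
have : exists M : nat, (mu [set x | (d c x <= n%:R)%R] < (M%:R / k.+1%:R)%:E)%E.
  have := meas_ge0 (mborel_cball c n%:R).
  case: (mu _) fin => [q| |]//= _; rewrite lee_fin => q0.
  exists (Num.truncn (q * k.+1%:R)).+1.
  by rewrite lte_fin ltr_pdivlMr// truncnS_gt.
move=> [M]; apply/negP; rewrite -leNgt.
have [B BP MB] := inf M.
have ms j := mborel_sphere c j.
have := meas_fibers (mborel_cball c n%:R) ms (finmap.fset_uniq B) => e.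
rewrite (@le_trans _ _ (mu ([set x | d c x <= n%:R] `&` [set x | d c x \in finmap.enum_fset B])))//; last first.
  apply: le_meas; [|exact: mborel_cball|exact: subIsetl].
  apply: mborelI; first exact: mborel_cball.
  exact: mborel_in_seq.
rewrite -e (@le_trans _ _ (\sum_(j <- finmap.enum_fset B) (k.+1%:R^-1)%:E)%E)//.
  rewrite sumEFin big_const_seq count_predT iter_addr addr0 lee_fin.
  by rewrite -[X in _ <= X]mulr_natl ler_wpM2r ?invr_ge0// ler_nat.
rewrite big_seq [leRHS]big_seq; apply: lee_sum => j jB.
have [jn] := BP j jB; move=> /le_trans; apply.
rewrite le_eqVlt; apply/orP; left; apply/eqP; congr mu.
apply/seteqP; split => x /=; last by case.
by move=> ->.
Qed.

End Measure.

(** The submeasure cut out of [meas X] will be such a combination, indexed by the cells. *)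
Lemma is_measure_sum (R : realType) (T : Type) (d : T -> T -> R) (J : Type)
    (r : seq J) (P : pred J) (c : J -> R) (m : J -> set T -> \bar R) :
  (forall j, 0 <= c j) -> (forall j, is_measure d (m j)) ->
  is_measure d (fun A => (\sum_(j <- r | P j) (c j)%:E * m j A)%E).
Proof.
move=> c0 hm; split; [|split].
- by rewrite big1// => j _; rewrite (meas0 (hm j)) mule0.
- move=> A hA; apply: sume_ge0 => j _; apply: mule_ge0; rewrite ?lee_fin//.
  exact: meas_ge0 (hm j) _ hA.
move=> F hF tF.
rewrite (_ : (fun n => _) = (fun n =>
    (\sum_(j <- r | P j) (c j)%:E * \sum_(0 <= i < n) m j (F i))%E)); last first.
  apply/funext => n; rewrite exchange_big/=; apply: eq_bigr => j _.
  by rewrite ge0_sume_distrr// => i _; exact: meas_ge0 (hm j) _ (hF i).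
have hU : mborel d (\bigcup_n F n) by exact: mborel_bigcup.
elim: r => [|j r ih].
  rewrite big_nil (_ : (fun n => _) = cst 0%E); first exact: cvg_cst.
  by apply/funext => n; rewrite big_nil.
rewrite big_cons; case: (boolP (P j)) => Pj; last first.
  by under eq_fun do rewrite big_cons (negbTE Pj).
under eq_fun do rewrite big_cons Pj.
apply: cvgeD => //.
  apply: ge0_adde_def; rewrite inE.
    by apply: mule_ge0; rewrite ?lee_fin// (meas_ge0 (hm j)).
  by apply: sume_ge0 => k _; apply: mule_ge0; rewrite ?lee_fin// (meas_ge0 (hm k)).
by apply: cvgeZl => //; case: (hm j) => _ [_]; exact.
Qed.

(** Injectivity of the inclusion keeps the images disjoint, and closedness of [S] keeps them Borel.
    Balls use [setT] for [q]; the cut submeasure uses a cell. *)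
Lemma is_measure_restrict (R : realType) (T : Type) (d : T -> T -> R)
    (mu : set T -> \bar R) (S q : set T) :
  is_metric d -> is_measure d mu -> mclosed d S -> mborel d q ->
  is_measure (fun a b : {x | S x} => d (proj1_sig a) (proj1_sig b))
    (fun A => mu (inc S @` A `&` q)).
Proof.
move=> dM muM cS bq; have bi A := @mborel_image_incl _ _ _ _ dM A cS.
split; [|split].
- by rewrite image_set0 set0I (meas0 muM).
- by move=> A /bi hA; apply: (meas_ge0 muM); exact: mborelI.
move=> F hF tF; rewrite image_bigcup setI_bigcupl; case: muM => _ [_]; apply.
  by move=> n; apply: mborelI => //; exact: bi.
apply/trivIsetP => i j _ _ ij; apply/seteqP; split => // x [[[u Fu <-] _] [[v Fv vu] _]].
have ? := incl_inj vu; subst v.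
have : (F i `&` F j) u by [].
by move/trivIsetP: tF => /(_ i j Logic.I Logic.I ij) ->.
Qed.

(** Stands for the minimum of finitely many positive constants, over a finite subcover or when one
    [e] has to meet several bounds. *)
Lemma finite_pos_witness (R : realType) (n : nat) (Q : nat -> R -> Prop) :
  (forall i e e', e' <= e -> Q i e -> Q i e') ->
  (forall i, (i < n)%N -> exists2 e, 0 < e & Q i e) ->
  exists2 e, 0 < e & forall i, (i < n)%N -> Q i e.
Proof.
move=> Qd; elim: n => [|n ih] h; first by exists 1.
have [|e1 e10 h1] := ih; first by move=> i ni; apply: h; rewrite ltnS ltnW.
have [e2 e20 h2] := h n (ltnSn n).
exists (Num.min e1 e2); first by rewrite lt_min e10.
move=> i; rewrite ltnS leq_eqVlt => /orP[/eqP->|/h1].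
  by apply: Qd h2; rewrite ge_min lexx orbT.
by apply: Qd; rewrite ge_min lexx.
Qed.

(** * Consequences of compactness: uniform constants, finite nets, finite unions *)

Section Compactness.
Context (R : realType) (T : Type) (d : T -> T -> R).
Hypothesis dM : is_metric d.

(** The open sets on which a single constant works cover [K]; the least constant of a finite
    subcover works everywhere. *)
Lemma mcompact_uniform (K : set T) (P : R -> T -> Prop) :
  (forall e e' x, e' <= e -> P e x -> P e' x) -> mcompact d K ->
  (forall x, K x -> exists e a : R, [/\ 0 < e, 0 < a & forall y, d x y < a -> P e y]) ->
  exists2 e, 0 < e & forall x, K x -> P e x.
Proof.
move=> Pd hK h.
pose F := [set U | mopen d U /\ exists2 e, 0 < e & forall y, U y -> P e y].
have [||n [G [hG1 hG2]]] := hK F; first by move=> U [].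
  move=> x /h[e [a [e0 a0 ha]]]; exists [set y | d x y < a].
    by split; [exact: mopen_oball|exists e].
  by rewrite /= ismetric_xx.
have [||e e0 he] := @finite_pos_witness R n (fun i e => forall y, G i y -> P e y).
- by move=> i e e' ee' k y /k; exact: Pd.
- by move=> i /hG1[_].
by exists e => // x /hG2[i /= ni]; exact: he.
Qed.

Lemma mcompact_net (K : set T) (x0 : T) (e : R) : mcompact d K -> K x0 -> 0 < e ->
  exists (n : nat) (x : nat -> T), (forall i, (i < n)%N -> K (x i)) /\
    forall y, K y -> exists2 i, (i < n)%N & d (x i) y < e.
Proof.
move=> hK Kx0 e0.
pose F := [set U | exists2 c, K c & U = [set y | d c y < e]].
have [||n [G [hG1 hG2]]] := hK F.
- by move=> U [c _ ->]; exact: mopen_oball.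
- by move=> x Kx; exists [set y | d x y < e]; [exists x|rewrite /= ismetric_xx].
have /choice[x hx] : forall i, exists c, (i < n)%N -> K c /\ G i = [set y | d c y < e].
  (* [x0] only fills the indices from [n] on. *)
  move=> i; case: (boolP (i < n)%N) => [/hG1[c Kc Gc]|_]; last by exists x0.
  by exists c.
exists n, x; split; first by move=> i /hx[].
by move=> y /hG2[i /= ni Gy]; exists i => //; have [_ Gi] := hx i ni; rewrite Gi in Gy.
Qed.

Lemma mcompact_bigcup_seq (I : eqType) (s : seq I) (A : I -> set T) :
  (forall i, mcompact d (A i)) ->
  mcompact d [set x | exists2 i, i \in s & A i x].
Proof.
move=> hA; elim: s => [|i s ih] F Fo Fc.
  by exists 0%N, (fun=> set0); split=> // x [].
have [|n1 [G1 [h1 k1]]] := hA i F Fo.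
  by move=> x Ax; apply: Fc; exists i; rewrite ?mem_head.
have [|n2 [G2 [h2 k2]]] := ih F Fo.
  by move=> x [j js Ax]; apply: Fc; exists j => //; rewrite inE js orbT.
exists (n1 + n2)%N, (fun i => if (i < n1)%N then G1 i else G2 (i - n1)%N); split.
  move=> k; case: (ltnP k n1) => [/h1 //|nk kn]; apply: h2.
  by rewrite ltn_subLR.
move=> x [j]; rewrite inE => /orP[/eqP->|js] Ax.
  have [l /= ln Gl] := k1 x Ax; exists l => /=; first by rewrite ltn_addr.
  by rewrite ln.
have [|l /= ln Gl] := k2 x; first by exists j.
exists (n1 + l)%N => /=; first by rewrite ltn_add2l.
by rewrite ltnNge leq_addr/= addKn.
Qed.

End Compactness.

(** * Distances between subspaces *)

Section GHP.
Context (R : realType).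
Implicit Types X Y : pmm R.

Lemma hausdorffC (T : Type) (d : T -> T -> R) A B : hausdorff d A B = hausdorff d B A.
Proof.
by rewrite /hausdorff; congr ereal_inf; congr image; apply/seteqP; split=> e /= [? [? ?]].
Qed.

Lemma prokhorovC (T : Type) (d : T -> T -> R) mu nu :
  prokhorov d mu nu = prokhorov d nu mu.
Proof.
rewrite /prokhorov; congr ereal_inf; congr image.
by apply/seteqP; split=> e /= [? h]; split=> // A /h[].
Qed.

Lemma dGHPcC X Y : dGHPc X Y = dGHPc Y X.
Proof.
rewrite /dGHPc; congr ereal_inf; apply/seteqP; split=> v [Z [dZ [f [g [dM fi gi ->]]]]].
all: exists Z, dZ, g, f; split=> //.
all: by rewrite (ismetric_sym dM) hausdorffC prokhorovC.
Qed.

Lemma dGHPc_ge0 X Y : (0 <= dGHPc X Y)%E.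
Proof.
apply: le_ereal_inf_tmp => v [Z [dZ [f [g [dM _ _ ->]]]]].
by rewrite !le_max lee_fin ismetric_ge0.
Qed.

(** One of the two inequalities in the Prokhorov distance of the pushforwards. [F] and [G] live on
    the whole carriers, so that no membership proofs have to be carried, but only their values on
    [S] and [T] count. *)
Definition measure_close (X Y : pmm R) (Z : Type) (dZ : Z -> Z -> R)
    (S : set (car X)) (nu : set {x | S x} -> \bar R) (F : car X -> Z)
    (T : set (car Y)) (nv : set {x | T x} -> \bar R) (G : car Y -> Z) (e : R) :=
  forall A, mclosed dZ A ->
    (nu (inc S @^-1` (F @^-1` A)) <= nv (inc T @^-1` (G @^-1` mnbhd dZ A e)) + e%:E)%E.

Lemma dGHPc_sub_le X Y (S : set (car X)) hS nu (T : set (car Y)) hT nv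
    (Z : Type) (dZ : Z -> Z -> R) (F : car X -> Z) (G : car Y -> Z) (e : R) :
  0 < e -> is_metric dZ ->
  (forall x y, S x -> S y -> dZ (F x) (F y) = dist X x y) ->
  (forall x y, T x -> T y -> dZ (G x) (G y) = dist Y x y) ->
  dZ (F (pt X)) (G (pt Y)) <= e ->
  (forall x, S x -> exists2 y, T y & dZ (F x) (G y) <= e) ->
  (forall y, T y -> exists2 x, S x & dZ (F x) (G y) <= e) ->
  measure_close dZ nu F nv G e -> measure_close dZ nv G nu F e ->
  (dGHPc (@sub_pmm R X S hS nu) (@sub_pmm R Y T hT nv) <= e%:E)%E.
Proof.
move=> e0 dM Fi Gi FG ST TS m1 m2.
apply: ge_ereal_inf.
exists (maxe (maxe (dZ (F (pt X)) (G (pt Y)))%:E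
   (hausdorff dZ (range (F \o inc S)) (range (G \o inc T))))
   (prokhorov dZ (fun A => nu ((F \o inc S) @^-1` A)) (fun A => nv ((G \o inc T) @^-1` A)))).
  exists Z, dZ, (F \o inc S), (G \o inc T); split => //.
  - by move=> [x Sx] [y Sy]; exact: Fi.
  - by move=> [x Tx] [y Ty]; exact: Gi.
rewrite !ge_max lee_fin FG /=; apply/andP; split.
- apply: ge_ereal_inf; exists e%:E => //; exists e => //; split => //; split.
  + move=> _ [[x Sx] _ <-]; have [y Ty h] := ST x Sx.
    by apply: in_mnbhd h; exists (exist _ y Ty).
  + move=> _ [[x Tx] _ <-]; have [y Sy h] := TS x Tx.
    by apply: (@in_mnbhd _ _ _ _ _ _ (F y)); [exists (exist _ y Sy)|rewrite (ismetric_sym dM)].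
- apply: ge_ereal_inf; exists e%:E => //; exists e => //; split => // A cA.
  by split; [exact: m1|exact: m2].
Qed.

(** The embeddings of the subtypes are extended to the whole carriers, and the strict inequality
    leaves room to reach the bound [e] itself in both infima. *)
Lemma dGHPc_sub_lt X Y (S : set (car X)) hS nu (T : set (car Y)) hT nv (e : R) :
  is_metric (dist X) -> is_metric (dist Y) -> is_subpmm X S nu -> is_subpmm Y T nv ->
  (dGHPc (@sub_pmm R X S hS nu) (@sub_pmm R Y T hT nv) < e%:E)%E ->
  exists (Z : Type) (dZ : Z -> Z -> R) (F : car X -> Z) (G : car Y -> Z),
  [/\ is_metric dZ,
    (forall x y, S x -> S y -> dZ (F x) (F y) = dist X x y) /\
    (forall x y, T x -> T y -> dZ (G x) (G y) = dist Y x y),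
    0 < e /\ dZ (F (pt X)) (G (pt Y)) <= e,
    (forall x, S x -> exists2 y, T y & dZ (F x) (G y) <= e) /\
    (forall y, T y -> exists2 x, S x & dZ (F x) (G y) <= e) &
    measure_close dZ nu F nv G e /\ measure_close dZ nv G nu F e].
Proof.
move=> dX dY [nuM _] [nvM _] /ereal_inf_lt[v [Z [dZ [f [g [dM fi gi ->]]]]]].
rewrite !gt_max => /andP[/andP[fg hh] pp].
have [_ [e1 [e10 [h1 h2]] <-]] := ereal_inf_lt hh; rewrite lte_fin => e1e.
have [_ [e2 [e20 h3] <-]] := ereal_inf_lt pp; rewrite lte_fin => e2e.
(* Outside [S] the value is arbitrary; the image of the root is taken. *)
pose ext (X : pmm R) (S : set (car X)) (hS : S (pt X)) (f : {x | S x} -> Z) x :=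
  if pselect (S x) is left h then f (exist _ x h) else f (exist _ (pt X) hS).
have extE (X' : pmm R) S' hS' f' x (h : S' x) : @ext X' S' hS' f' x = f' (exist _ x h).
  by rewrite /ext; case: pselect => // h'; congr f'; congr exist; exact: Prop_irrelevance.
have extE' (X' : pmm R) S' hS' f' u : @ext X' S' hS' f' (inc S' u) = f' u.
  by case: u => x h /=; exact: extE.
exists Z, dZ, (ext _ _ hS f), (ext _ _ hT g); split => //.
- by split=> x y hx hy; rewrite !extE; [exact: fi|exact: gi].
- split; first by lra.
  by rewrite !extE ltW// -lte_fin.
- split=> x hx; rewrite extE.
    (* The slack [e - e1] serves as the [delta] of [mnbhd]. *)
    have [|_ [y _ <-] /ltW h] := h1 (f (exist _ x hx)) (ex_intro2 _ _ _ Logic.I erefl) (e - e1).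
      lra.
    exists (inc T y); first by case: y {h}.
    by rewrite extE'; move: h; rewrite addrC subrK.
  have [|_ [y _ <-] /ltW h] := h2 (g (exist _ x hx)) (ex_intro2 _ _ _ Logic.I erefl) (e - e1).
    lra.
  exists (inc S y); first by case: y {h}.
  by rewrite extE' (ismetric_sym dM); move: h; rewrite addrC subrK.
have pE (X' : pmm R) S' hS' f' A : inc S' @^-1` (@ext X' S' hS' f' @^-1` A) = f' @^-1` A.
  by apply/seteqP; split => u /=; rewrite extE'.
have close_le (X1 : pmm R) (S1 : set (car X1)) (f1 : {x | S1 x} -> Z) nu1 A :
    is_measure (fun a b : {x | S1 x} => dist X1 (proj1_sig a) (proj1_sig b)) nu1 ->
    isometric (fun a b : {x | S1 x} => dist X1 (proj1_sig a) (proj1_sig b)) dZ f1 ->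
    (nu1 (f1 @^-1` mnbhd dZ A e2) + e2%:E <= nu1 (f1 @^-1` mnbhd dZ A e) + e%:E)%E.
  move=> nuM1 f1i; apply: leeD; last by rewrite lee_fin ltW.
  apply: (le_meas nuM1).
  - by apply: mborel_closed; apply: isometric_closed f1i (mclosed_mnbhd dM _ _).
  - by apply: mborel_closed; apply: isometric_closed f1i (mclosed_mnbhd dM _ _).
  - by move=> u; apply: mnbhd_le => //; exact: ltW.
split=> A cA; rewrite !pE; have [k1 k2] := h3 A cA.
  exact: le_trans k1 (close_le _ _ _ _ _ nvM gi).
exact: le_trans k2 (close_le _ _ _ _ _ nuM fi).
Qed.

End GHP.

(** * Balls and continuity radii *)

(** A countable set is Lebesgue-null, while the interval has positive length. *)
Lemma exists_notin_countable (R : realType) (A : set R) a b :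
  countable A -> a < b -> exists2 r, a < r < b & ~ A r.
Proof.
move=> cA ab; apply: contrapT => h.
have : lebesgue_measure (`]a, b[%classic : set R) = 0%E.
  apply: countable_lebesgue_measure0; apply: sub_countable cA.
  apply: subset_card_le => r /=; rewrite in_itv /= => abr.
  by apply: contrapT => nA; apply: h; exists r.
rewrite lebesgue_measure_itv /= lte_fin ab -EFinD => -[]; lra.
Qed.

Section Balls.
Context (R : realType) (X : pmm R).
Hypotheses (XM : is_pmm X) (XC : bcompact X).
Let dM : is_metric (dist X) := XM.1.
Let muM : is_measure (dist X) (meas X) := XM.2.

Lemma ballsetE r : 0 <= r -> ballset X r = cball X r.
Proof.
move=> r0; apply/seteqP; split => y /=; last by right.
by move=> [->|//]; rewrite /cball /cballc /= ismetric_xx.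
Qed.

Lemma mborel_ball r : mborel (dist X) (cball X r).
Proof. exact: mborel_cball dM _ _. Qed.

Lemma ball_is_subpmm r : 0 <= r ->
  is_subpmm X (ballset X r) (fun A => meas X (inc (ballset X r) @` A)).
Proof.
move=> r0; have cB : mclosed (dist X) (ballset X r).
  by rewrite ballsetE//; exact: mclosed_cball dM _ _.
split.
  have -> : (fun A => meas X (inc (ballset X r) @` A)) =
            (fun A => meas X (inc (ballset X r) @` A `&` setT)).
    by apply/funext => A; rewrite setIT.
  exact: is_measure_restrict dM muM cB (@mborelT _ _ _).
move=> A bA; rewrite image_incl_preimage; apply: (le_meas muM) => //.
by apply: mborelI => //; exact: mborel_closed.
Qed.

Lemma ball_compact_pmm r : 0 <= r -> compact_pmm (ballpmm X r).
Proof.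
move=> r0; split.
  by apply: (mcompact_sub dM); rewrite ballsetE//; exact: XC.1.
rewrite /= -(preimage_setT (inc (ballset X r))) image_incl_preimage setTI ballsetE//.
by apply: (meas_cball_fin dM muM) => c t; exact: XC.2.
Qed.

Lemma ball_ball_le r t : 0 <= r -> t <= r ->
  ball_le X t (ballset X r) (fun A => meas X (inc (ballset X r) @` A)).
Proof.
move=> r0 tr; have sub : cball X t `<=` ballset X r.
  by move=> x /= h; right; exact: le_trans h tr.
split=> // A bA; rewrite image_incl_preimage; apply: (le_meas muM).
- by apply: mborelI => //; exact: mborel_ball.
- by apply: mborelI => //; rewrite ballsetE//; exact: mborel_ball.
- exact: setIS.
Qed.

(* Radii at which [x |-> dist o x] has a local minimum value; distinct ones
   correspond to separated points, so compactness leaves finitely many with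
   given isolation constant. *)
Lemma countable_local_min_radii : countable [set r | exists2 y, dist X (pt X) y = r &
  exists2 e, 0 < e & forall z, dist X (pt X) z < r -> e <= dist X y z].
Proof.
pose Q (nk : nat * nat) r y := [/\ r <= nk.1%:R, dist X (pt X) y = r &
  forall z, dist X (pt X) z < r -> nk.2.+1%:R^-1 <= dist X y z].
apply: (@sub_countable _ _ _ (\bigcup_(nk in setT) [set r | exists y, Q nk r y])).
  apply: subset_card_le => r /= [y yr [e e0 he]].
  have [k _ /(_ k (leqnn k)) /= hk] := near_infty_natSinv_lt (PosNum e0).
  exists ((Num.truncn `|r|%R).+1, k) => //=; exists y; split => //=.
    by rewrite (le_trans (ler_norm r))// ltW// truncnS_gt.
  by move=> z /he; apply: le_trans; exact: ltW.
apply: bigcup_countable => // -[n k] _; apply: finite_set_countable.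
(* With [a] half the isolation constant, two points within [a] of one net point are closer than that
   constant. *)
have [a a0 aE] : exists2 a : R, 0 < a & k.+1%:R^-1 = a + a.
  by exists (k.+1%:R^-1 / 2); rewrite -?splitr ?divr_gt0 ?invr_gt0.
have o0 : cball X n%:R (pt X) by rewrite /cball /cballc /= ismetric_xx.
have [N [x [_ hx]]] := mcompact_net dM (XC.1 (pt X) n%:R) o0 a0.
pose P i r := exists2 y, Q (n, k) r y & dist X (x i) y < a.
(* One candidate radius per net point, with 0 as default; these will turn out to exhaust the
   radii. *)
have /choice[g hg] : forall i, exists r, forall r', P i r' -> P i r.
  move=> i; case: (pselect (exists r, P i r)) => [[r h]|h]; first by exists r.
  by exists 0 => r' h'; case: h; exists r'.
apply: (@sub_finite_set _ _ (g @` `I_N)); last first.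
  by apply: finite_image; exact: finite_II.
move=> r [y hy]; have [rn yr _] := hy.
have [|i iN iy] := hx y; first by rewrite /cball /cballc /= yr.
have Pr : P i r by exists y.
exists i => //; have [y' [_ yr' h'] iy'] := hg i r Pr.
rewrite /= aE in h'.
have yy' : dist X y y' < a + a.
  have := ismetric_tri dM (x i) y y'; rewrite (ismetric_sym dM y (x i)).
  lra.
have [_ _ /= h] := hy; rewrite aE in h.
(* If the radii differed, the point nearer to the root would violate the isolation of the other. *)
apply/eqP; rewrite eq_le; apply/andP; split; rewrite leNgt; apply/negP => lt.
  have := h' y; rewrite yr => /(_ lt); rewrite (ismetric_sym dM) /=; lra.
have := h y'; rewrite yr' => /(_ lt) /=; lra.
Qed.

Lemma meas_sphereE r :
  meas X (cball X r `\` @oballc R X (pt X) r) = meas X [set x | dist X (pt X) x = r].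
Proof.
congr meas; apply/seteqP; split => x /=; rewrite /cball /cballc /oballc /=.
  by move=> [h1 /negP]; rewrite -leNgt => h2; apply/eqP; rewrite eq_le h1.
by move=> ->; split=> //; rewrite ltxx.
Qed.

(** There are two ways to fail: the sphere has mass, or a point at distance exactly [r] is isolated
    from the open ball. Each happens for countably many radii. *)
Lemma countable_not_continuity_radius :
  countable [set r | 0 < r /\ ~ continuity_radius X r].
Proof.
have h1 := countable_heavy_spheres dM muM (fun c r => XC.2 c r) (pt X).
have h2 := countable_local_min_radii.
set H := [set r | _ != _] in h1; set L := [set r | _] in h2.
have h12 : countable (\bigcup_n bigcup2 H L n).
  by apply: bigcup_countable => // -[|[|n]] _; rewrite /bigcup2 /=.
apply: sub_countable h12; rewrite bigcup2E.
apply: subset_card_le => r [r0 ncr]; apply: contrapT => /not_orP[/= nh nm].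
apply: ncr; split => //; last first.
  by rewrite meas_sphereE; apply/eqP/negPn/negP.
move=> y; split => [yr e e0|h].
  apply: contrapT => ne; apply: nm.
  have far z : dist X (pt X) z < r -> e <= dist X y z.
    by move=> zr; rewrite leNgt; apply/negP => zy; apply: ne; exists z.
  exists y; last by exists e.
  apply/eqP; rewrite eq_le yr /= leNgt; apply/negP => lt.
  have := far y lt; rewrite ismetric_xx//; lra.
apply/ler_addgt0Pr => e e0; have [z zr yz] := h e e0.
have := ismetric_tri dM z (pt X) y; rewrite (ismetric_sym dM z); lra.
Qed.

Lemma exists_continuity_radius a b : 0 <= a -> a < b ->
  exists2 r, a < r < b & continuity_radius X r.
Proof.
move=> a0 ab; have [r /andP[ar rb] h] := exists_notin_countable countable_not_continuity_radius ab.
exists r; rewrite ?ar//; apply: contrapT => ncr; apply: h; split => //.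
exact: le_lt_trans ar.
Qed.

End Balls.

(** * Comparing balls *)

Section Bridge.
Context (R : realType).
Implicit Types X Y : pmm R.

Definition isometric_ball X (s : R) (Z : Type) (dZ : Z -> Z -> R) (F : car X -> Z) :=
  forall x y, cball X s x -> cball X s y -> dZ (F x) (F y) = dist X x y.

(** The root and a point each move by at most [e], so radii shift by at most [2 * e]. The bounds by
    [s] keep all points in the balls where [F] and [G] are isometric. *)
Definition half_bridge X Y (s e : R) (Z : Type) (dZ : Z -> Z -> R)
    (F : car X -> Z) (G : car Y -> Z) :=
  (forall x, dist X (pt X) x + 2 * e <= s ->
     exists2 y, dist Y (pt Y) y <= dist X (pt X) x + 2 * e & dZ (F x) (G y) <= e) /\
  (forall t A, t + 2 * e <= s -> mclosed dZ A ->
    (meas X (cball X t `&` F @^-1` A) <=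
     meas Y (cball Y (t + 2 * e)%R `&` G @^-1` mnbhd dZ A e) + e%:E)%E).

(* Closeness of some pmm-subspaces containing the balls of radius [s], with the
   subspaces eliminated: only balls of radius at most [s] are compared. *)
Definition bridge X Y (s e : R) :=
  exists (Z : Type) (dZ : Z -> Z -> R) (F : car X -> Z) (G : car Y -> Z),
  [/\ is_metric dZ, isometric_ball s dZ F /\ isometric_ball s dZ G,
      0 < e /\ dZ (F (pt X)) (G (pt Y)) <= e,
      half_bridge s e dZ F G & half_bridge s e dZ G F].

(** [F] is controlled only on the ball of radius [s], so the preimage of [A] alone need not be
    closed. *)
Lemma mclosed_ball_preimage X (s t : R) (Z : Type) (dZ : Z -> Z -> R)
    (F : car X -> Z) A :
  is_metric (dist X) -> isometric_ball s dZ F -> t <= s -> mclosed dZ A ->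
  mclosed (dist X) (cball X t `&` F @^-1` A).
Proof.
move=> dM Fi ts cA x /= nx.
have [xt|xt] := leP (dist X (pt X) x) t; last first.
  have [e e0 he] := mopen_gt dM (pt X) t x xt.
  by exists e => // y /he /= h [+ _]; rewrite /cball /cballc /= leNgt h.
have nA : (~` A) (F x) by move=> Ax; apply: nx.
have [e e0 he] := cA _ nA.
exists e => // y /= xy [yt Ay]; apply: (he (F y)) => //=.
rewrite Fi //; exact: le_trans ts.
Qed.

Lemma half_bridge_of_sub X Y (s e : R) (Z : Type) (dZ : Z -> Z -> R)
    (F : car X -> Z) (G : car Y -> Z) S nu T nv :
  is_metric (dist X) -> is_metric (dist Y) -> is_metric dZ ->
  S (pt X) -> T (pt Y) -> ball_le X s S nu -> is_subpmm Y T nv -> ball_le Y s T nv ->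
  (forall x y, S x -> S y -> dZ (F x) (F y) = dist X x y) ->
  (forall x y, T x -> T y -> dZ (G x) (G y) = dist Y x y) ->
  0 < e -> dZ (F (pt X)) (G (pt Y)) <= e ->
  (forall x, S x -> exists2 y, T y & dZ (F x) (G y) <= e) ->
  measure_close dZ nu F nv G e ->
  half_bridge s e dZ F G.
Proof.
move=> dX dY dM So To [sS leS] [nvM leY] [sT leT] Fi Gi e0 oo ST m; split.
  move=> x xs; have Sx : S x by apply: sS; rewrite /cball /cballc /=; lra.
  have [y Ty xy] := ST x Sx; exists y => //.
  rewrite -(Gi _ _ To Ty) -(Fi _ _ So Sx).
  have := ismetric_tri dM (F (pt X)) (G (pt Y)) (G y).
  have := ismetric_tri dM (F x) (F (pt X)) (G y).
  rewrite (ismetric_sym dM (G (pt Y)) (F (pt X))); lra.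
move=> t A ts cA.
have Fs : isometric_ball s dZ F by move=> x y /sS hx /sS hy; exact: Fi.
have Gs : isometric_ball s dZ G by move=> x y /sT hx /sT hy; exact: Gi.
have ts' : t <= s by lra.
(* Truncating [A] by a ball of [Z] keeps its [e]-neighbourhood within [t + e] of [F (pt X)], hence
   within [t + 2 * e] of [G (pt Y)]. *)
pose A' := A `&` [set z | dZ (F (pt X)) z <= t].
have cA' : mclosed dZ A' by apply: mclosedI => //; exact: mclosed_cball dM _ _.
have cB := mclosed_ball_preimage dX Fs ts' cA.
have cC := mclosed_ball_preimage dY Gs ts (mclosed_mnbhd dM A e).
have -> : cball X t `&` F @^-1` A = (cball X t `&` F @^-1` A) `&` cball X s.
  apply/seteqP; split => x; last by case.
  by move=> [h1 h2]; split => //; exact: le_trans ts'.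
apply: (le_trans (leS _ (mborel_closed cB))).
have -> : inc S @^-1` (cball X t `&` F @^-1` A) = inc S @^-1` (F @^-1` A').
  apply/seteqP; split => -[x Sx] /=; rewrite /A' /cball /cballc /= Fi//.
    by move=> [].
  by move=> [].
apply: (le_trans (m A' cA')); rewrite leeD2r//.
apply: (@le_trans _ _ (nv (inc T @^-1`
    (cball Y (t + 2 * e) `&` G @^-1` mnbhd dZ A e)))); last first.
  exact: leY (mborel_closed cC).
apply: (le_meas nvM).
- apply: mborel_closed; apply: (@isometric_closed _ _ _ _ dZ (G \o inc T)).
    by move=> [x Tx] [y Ty]; exact: Gi.
  exact: mclosed_mnbhd dM _ _.
- exact: mborel_incl (mborel_closed cC).
- move=> [y Ty] /= h; split; last first.
    by apply: mnbhd_le h => //; exact: subIsetl.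
  rewrite /cball /cballc /= -(Gi _ _ To Ty).
  have := mnbhd_dist_le dM (A := A') (c := F (pt X)) (t := t) (fun _ h => h.2) h.
  have := ismetric_tri dM (F (pt X)) (G (pt Y)) (G y).
  rewrite (ismetric_sym dM (G (pt Y)) (F (pt X))); lra.
Qed.

Lemma bridge_of_dGHPc X Y (s e : R) S hS nu T hT nv :
  is_pmm X -> is_pmm Y ->
  is_subpmm X S nu -> ball_le X s S nu -> is_subpmm Y T nv -> ball_le Y s T nv ->
  (dGHPc (@sub_pmm R X S hS nu) (@sub_pmm R Y T hT nv) < e%:E)%E -> bridge X Y s e.
Proof.
move=> [dX _] [dY _] subX leX subY leY.
move=> /(dGHPc_sub_lt dX dY subX subY)[Z [dZ [F [G [dM [Fi Gi] [e0 oo] [h1 h2] [m1 m2]]]]]].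
exists Z, dZ, F, G; split => //.
- split.
    by move=> x y hx hy; apply: Fi; exact: leX.1.
  by move=> x y hx hy; apply: Gi; exact: leY.1.
- exact: (half_bridge_of_sub dX dY dM hS hT leX subY leY Fi Gi e0 oo).
- apply: (half_bridge_of_sub dY dX dM hT hS leY subX leX Gi Fi e0) => //.
    by rewrite (ismetric_sym dM).
  by move=> y /h2[x Sx h]; exists x => //; rewrite (ismetric_sym dM).
Qed.

(** Each [x] in the closed ball is near a point [z] of the open ball, and the same [z] serves all
    points close to [x]; compactness makes the gap below [r] uniform. *)
Lemma continuity_radius_inner X r eta : is_pmm X -> bcompact X ->
  continuity_radius X r -> 0 < eta ->
  exists2 e, 0 < e & forall x, dist X (pt X) x <= r ->
    exists2 z, dist X (pt X) z <= r - e & dist X x z <= eta.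
Proof.
move=> [dM _] [XC _] [r0 hr _] eta0.
have [||e e0 he] := @mcompact_uniform _ _ _ dM (cball X r) (fun e x =>
    exists2 z, dist X (pt X) z <= r - e & dist X x z <= eta) _ (XC _ _).
- by move=> e e' x ee' [z zr xz]; exists z => //; lra.
- move=> x /hr /(_ (eta / 2))[|z zr xz]; first lra.
  exists (r - dist X (pt X) z), (eta / 2); split; [lra..|].
  move=> y xy; exists z; first by rewrite opprB addrC subrK.
  have := ismetric_tri dM x y z; rewrite (ismetric_sym dM y x); lra.
by exists e.
Qed.

(** This holds at every radius: near a point farther than [r] from the root the condition is void
    for small [e], and compactness of a larger ball gives a common [e]. *)
Lemma ball_outer X r eta : is_pmm X -> bcompact X -> 0 < eta ->
  exists2 e, 0 < e & forall x, dist X (pt X) x <= r + e ->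
    exists2 z, dist X (pt X) z <= r & dist X x z <= eta.
Proof.
move=> [dM _] [XC _] eta0.
have [||e e0 he] := @mcompact_uniform _ _ _ dM (cball X (r + 1)) (fun e x =>
    dist X (pt X) x <= r + e ->
    exists2 z, dist X (pt X) z <= r & dist X x z <= eta) _ (XC _ _).
- by move=> e e' x ee' h xr; apply: h; lra.
- move=> x _; have [xr|xr] := leP (dist X (pt X) x) r.
    exists 1, eta; split => // y xy _; exists x => //.
    by rewrite (ismetric_sym dM) ltW.
  exists ((dist X (pt X) x - r) / 2), ((dist X (pt X) x - r) / 2).
  split; [lra..|move=> y xy yr].
  have := ismetric_tri dM y (pt X) x; rewrite (ismetric_sym dM y x); lra.
exists (Num.min e 1); first by rewrite lt_min e0 ltr01.
move=> x h; apply: he.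
  by rewrite /cball /cballc /=; apply: (le_trans h); rewrite lerD2l ge_min lexx orbT.
by apply: (le_trans h); rewrite lerD2l ge_min lexx.
Qed.

(** A bridge compares balls whose radii differ by [2 * e]; at a continuity radius this changes the
    ball of [X] little, both in Hausdorff distance and in mass. As [s] and [e] do not depend on [Y],
    they serve a whole sequence. *)
Lemma bridge_ball_close X r e0 : is_pmm X -> bcompact X ->
  continuity_radius X r -> 0 < e0 ->
  exists s e : R, [/\ 0 < s, 0 < e & forall Y, is_pmm Y -> bcompact Y ->
    bridge X Y s e -> (dGHPc (ballpmm Y r) (ballpmm X r) <= e0%:E)%E].
Proof.
move=> XM XC cr e00; have [r0 _ rs] := cr; have [dX muX] := XM.
have e02 : 0 < e0 / 2 by lra.
rewrite meas_sphereE in rs.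
have [d1 d10 h1] := meas_annulus_small dX muX (fun c r => XC.2 c r) rs e02.
have [d2 d20 h2] := continuity_radius_inner XM XC cr e02.
have [d3 d30 h3] := ball_outer r XM XC e02.
have [e [ep ed1 ed2 ed3] [ee0 e1]] : exists2 e, [/\ 0 < e, 2 * e <= d1, 2 * e <= d2 & 2 * e <= d3]
    & 2 * e <= e0 /\ 2 * e <= 1.
  (* Index 4 falls off the list, and the default value 1 gives [2 * e <= 1]. *)
  have [||e ep he] := @finite_pos_witness R 5 (fun i e => 2 * e <= nth 1 [:: d1; d2; d3; e0] i).
  - by move=> i e e' ee'; apply: le_trans; rewrite ler_pM2l.
  - move=> i _; have : 0 < nth 1 [:: d1; d2; d3; e0] i.
      by case: i => [|[|[|[|[|i]]]]].
    by move: (nth _ _ _) => q q0; exists (q / 2); lra.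
  by exists e; split => //; [exact: (he 0%N)|exact: (he 1%N)|exact: (he 2%N)
    |exact: (he 3%N)|exact: (he 4%N)].
exists (r + 1), e; split => //; first lra.
move=> Y YM YC; have [dY muY] := YM.
move=> [Z [dZ [F [G [dM [Fi Gi] [_ oo] [hFG mFG] [hGF mGF]]]]]].
have r0' := ltW r0.
have inX x : dist X (pt X) x <= r -> cball X (r + 1) x by rewrite /cball /cballc /=; lra.
have inY x : dist Y (pt Y) x <= r -> cball Y (r + 1) x by rewrite /cball /cballc /=; lra.
have bX t A : t <= r + 1 -> mclosed dZ A -> mborel (dist X) (cball X t `&` F @^-1` A).
  by move=> tr cA; exact: mborel_closed (mclosed_ball_preimage dX Fi tr cA).
have bY t A : t <= r + 1 -> mclosed dZ A -> mborel (dist Y) (cball Y t `&` G @^-1` A).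
  by move=> tr cA; exact: mborel_closed (mclosed_ball_preimage dY Gi tr cA).
apply: (@dGHPc_sub_le _ _ _ _ _ _ _ _ _ Z dZ G F) => //.
- by rewrite !ballsetE// => x y hx hy; apply: Gi; exact: inY.
- by rewrite !ballsetE// => x y hx hy; apply: Fi; exact: inX.
- by rewrite (ismetric_sym dM); lra.
(* The partner in [X] may lie slightly outside the ball; [h3] pulls it back. *)
- rewrite !ballsetE// => y yr.
  have [|x xr xy] := hGF y; first by rewrite /cball /cballc /= in yr; lra.
  have xr' : dist X (pt X) x <= r + d3 by rewrite /cball /cballc /= in yr; lra.
  have [z zr xz] := h3 x xr'; exists z => //.
  have := ismetric_tri dM (F x) (G y) (F z).
  rewrite Fi //; [lra| |exact: inX].
  by rewrite /cball /cballc /= in yr *; lra.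
(* The point is first pushed inward by [h2], so that its partner stays in the ball of [Y]. *)
- rewrite !ballsetE// => x xr.
  have [z zr xz] := h2 x xr.
  have [|y yr zy] := hFG z; first lra.
  exists y; first by rewrite /cball /cballc /=; lra.
  have := ismetric_tri dM (F z) (F x) (G y); rewrite Fi; last 2 first.
  + exact: inX.
  + by apply: inX; lra.
  by rewrite (ismetric_sym dM (G y) (F x)); lra.
- move=> A cA; rewrite !image_incl_preimage !ballsetE// ![_ `&` cball _ r]setIC.
  apply: (@le_trans _ _ (meas X (cball X (r + 2 * e) `&` F @^-1` mnbhd dZ A e) + e%:E)).
    by apply: mGF => //; lra.
  have cN := mclosed_mnbhd dM A.
  (* The mass gained between [r] and [r + 2 * e] lies in the annulus of [h1]. *)
  apply: (@le_trans _ _ (meas X (cball X r `&` F @^-1` mnbhd dZ A e0) + (e0 / 2)%:E + e%:E)).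
    rewrite leeD2r//; apply: le_trans (leeD2l _ h1).
    apply: (meas_subU muX).
    + by apply: bX => //; lra.
    + by apply: bX => //; lra.
    + exact: mborel_closed (@mclosed_annulus _ _ _ dX _ _ _).
    move=> x [xr Ax]; rewrite /cball /cballc /= in xr.
    have [xr'|xr'] := leP (dist X (pt X) x) r.
      by left; split => //; apply: mnbhd_le Ax => //; lra.
    by right; rewrite /= ler_distl; lra.
  by rewrite -addeA leeD2l// -EFinD lee_fin; lra.
- move=> A cA; rewrite !image_incl_preimage !ballsetE// ![_ `&` cball _ r]setIC.
  have cN := mclosed_mnbhd dM A.
  (* The shell between [r - 2 * e] and [r] is given up first; it lies in the same annulus. *)
  apply: (@le_trans _ _ (meas X (cball X (r - 2 * e) `&` F @^-1` A) + (e0 / 2)%:E)).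
    apply: le_trans (leeD2l _ h1).
    apply: (meas_subU muX).
    + by apply: bX => //; lra.
    + by apply: bX => //; lra.
    + exact: mborel_closed (@mclosed_annulus _ _ _ dX _ _ _).
    move=> x [xr Ax]; rewrite /cball /cballc /= in xr.
    have [xr'|xr'] := leP (dist X (pt X) x) (r - 2 * e); first by left.
    by right; rewrite /= ler_distl; lra.
  have k : r - 2 * e + 2 * e <= r + 1 by lra.
  have := mFG _ A k cA; rewrite subrK => /(leeD2r (e0 / 2)%:E) /le_trans; apply.
  rewrite -addeA leeD//; last by rewrite -EFinD lee_fin; lra.
  apply: (le_meas muY).
  + by apply: bY => //; lra.
  + by apply: bY => //; lra.
  + by move=> y [yr hy]; split => //; apply: mnbhd_le hy => //; lra.
Qed.

End Bridge.

(** * Cutting a submeasure *)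

(** The factor is 1 if [P] holds or [m <= b], and [b / m] otherwise. [P] will say that a cell meets
    the inner ball, where the full mass of [X] must be kept. *)
Lemma weight_exists (R : realType) (m b th : \bar R) (P : Prop) :
  m \is a fin_num -> b \is a fin_num -> th \is a fin_num ->
  (0 <= m)%E -> (0 <= b)%E -> (0 <= th)%E ->
  (b <= m + th)%E -> (P -> m <= b + th)%E ->
  exists c : R, [/\ 0 <= c <= 1, P -> c = 1,
    (c%:E * m <= b + th)%E & (b <= c%:E * m + th)%E].
Proof.
case: m => // m _; case: b => // b _; case: th => // th _.
rewrite !lee_fin => m0 b0 t0 h1 h2.
have [p|np] := pselect P.
  by have := h2 p; exists 1; rewrite ?mul1e -?EFinD ?lee_fin ler01 lexx.
have [mb|bm] := leP m b.
  by exists 1; split => //; rewrite ?ler01 ?lexx// ?mul1e -?EFinD lee_fin; lra.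
have m0' : 0 < m by lra.
exists (b / m); rewrite -EFinM divfK ?gt_eqF// -EFinD !lee_fin; split => //.
- by rewrite divr_ge0//= ler_pdivrMr// mul1r ltW.
- by lra.
- by lra.
Qed.

(* Both spaces are cut into cells according to which of the balls of radius
   [rho] around the net points [xs i] contain a point.  As the spheres of these
   balls are almost null, corresponding cells have almost equal masses, and a
   submeasure of [meas X] matching the ball of [Y] is obtained by rescaling
   [meas X] on each cell. *)
Section Cells.
Context (R : realType) (X Y : pmm R) (r p rho eta ep e : R) (k : nat)
  (xs : nat -> car X) (Z : Type) (dZ : Z -> Z -> R) (F : car X -> Z) (G : car Y -> Z).
Hypotheses (XM : is_pmm X) (XC : bcompact X) (YM : is_pmm Y) (YC : bcompact Y).
Hypotheses (r0 : 0 < r) (p0 : 0 < p) (p1 : p <= 1) (rho8 : p / 8 < rho)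
  (rho4 : rho < p / 4) (e0 : 0 < e) (e2 : 2 * e <= ep) (erho : e <= rho - p / 8)
  (ep4 : 4 * e <= p) (eta0 : 0 <= eta).
Hypothesis xsr : forall i, (i < k)%N -> dist X (pt X) (xs i) <= r + 1.
Hypothesis net : forall y, dist X (pt X) y <= r + 1 ->
  exists2 i, (i < k)%N & dist X (xs i) y < p / 8.
Let N := [set y | (exists2 i, (i \in iota 0 k) & `|dist X (xs i) y - rho| <= ep)].
Hypothesis NE : (meas X N <= eta%:E)%E.
Hypothesis Keta : #|{set 'I_k}|%:R * (eta + e) <= p / 2.
Hypotheses (dM : is_metric dZ) (Fi : isometric_ball (r + 3) dZ F)
  (Gi : isometric_ball (r + 3) dZ G) (oo : dZ (F (pt X)) (G (pt Y)) <= e)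
  (FG : half_bridge (r + 3) e dZ F G) (GF : half_bridge (r + 3) e dZ G F).

Ltac slra := move: r0 p0 p1 rho8 rho4 e0 e2 erho ep4 eta0; lra.

Let dX : is_metric (dist X) := XM.1.
Let muX : is_measure (dist X) (meas X) := XM.2.
Let dY : is_metric (dist Y) := YM.1.
Let muY : is_measure (dist Y) (meas Y) := YM.2.
Let theta := eta + e.

Definition sigX (x : car X) : {set 'I_k} := [set i : 'I_k | dist X (xs i) x <= rho]%SET.
(** The ball condition sits inside the signature, so a point outside the ball of [Y] has the empty
    signature and lies in no active cell. *)
Definition sigY (y : car Y) : {set 'I_k} :=
  [set i : 'I_k | (dist Y (pt Y) y <= r) && (dZ (F (xs i)) (G y) <= rho)]%SET.
Definition reached (i : 'I_k) : bool :=
  `[< exists2 y, dist Y (pt Y) y <= r & dZ (F (xs i)) (G y) <= rho >].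
Definition active (J : {set 'I_k}) : bool := [exists i, (i \in J) && reached i].
(** Only balls around reached net points enter, so that every point of the support has a partner in
    the ball of [Y] within [2 * rho < p / 2]. *)
Definition support : set (car X) :=
  [set x | exists2 i, i \in [seq i <- enum 'I_k | reached i] & dist X (xs i) x <= rho].
(** A closed substitute in [Z] for the cell [J], to which the mass inequalities of a bridge apply:
    distances to the net stay on the side of [rho] prescribed by [J], with margin [a]. *)
Definition core (J : {set 'I_k}) (a : R) : set Z :=
  [set z | forall i : 'I_k, if i \in J then dZ (F (xs i)) z <= rho - a
                          else rho + a <= dZ (F (xs i)) z].

Lemma sigXP (i : 'I_k) x : i \in sigX x = (dist X (xs i) x <= rho).
Proof. by rewrite inE. Qed.

Lemma sigYP (i : 'I_k) y : dist Y (pt Y) y <= r -> i \in sigY y = (dZ (F (xs i)) (G y) <= rho).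
Proof. by move=> h; rewrite inE h. Qed.

Lemma sigY_ball (i : 'I_k) y : i \in sigY y -> dist Y (pt Y) y <= r.
Proof. by rewrite inE => /andP[]. Qed.

Lemma dist_xs_F (i : 'I_k) x : dist X (pt X) x <= r + 3 ->
  dZ (F (xs i)) (F x) = dist X (xs i) x.
Proof.
move=> xr; apply: Fi => //; rewrite /cball /cballc /=.
have := xsr (ltn_ord i); slra.
Qed.

Lemma near_xs_ball (i : 'I_k) x : dist X (xs i) x <= rho -> dist X (pt X) x <= r + 2.
Proof.
move=> h; have := ismetric_tri dX (xs i) (pt X) x; have := xsr (ltn_ord i); slra.
Qed.

Lemma activeP (J : {set 'I_k}) : reflect (exists2 i, i \in J & reached i) (active J).
Proof.
apply: (iffP existsP) => [[i /andP[? ?]]|[i ? ?]]; first by exists i.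
by exists i; apply/andP.
Qed.

Lemma supportP x : support x <-> exists2 i : 'I_k, reached i & dist X (xs i) x <= rho.
Proof.
split=> [[i]|[i ir ix]]; first by rewrite mem_filter => /andP[ir _] ix; exists i.
by exists i => //; rewrite mem_filter ir mem_enum.
Qed.

Lemma active_sigX_support x : active (sigX x) -> support x.
Proof. by move=> /activeP[i]; rewrite sigXP => ix ir; apply/supportP; exists i. Qed.

Lemma support_ball x : support x -> dist X (pt X) x <= r + 2.
Proof. by move=> /supportP[i _]; exact: near_xs_ball. Qed.

Lemma mclosed_support : mclosed (dist X) support.
Proof. by apply: mclosed_bigcup_seq => i; exact: mclosed_cball dX _ _. Qed.

Lemma mcompact_support : mcompact (dist X) support.
Proof. by apply: mcompact_bigcup_seq => i; exact: XC.1. Qed.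

(** A partner of [y] lies within [p / 8] of some net point, and [p / 8 + e <= rho]. *)
Lemma active_sigY y : dist Y (pt Y) y <= r -> active (sigY y).
Proof.
move=> yr; have [|x xr yx] := GF.1 y; first slra.
have [|i ik ix] := net (y := x); first slra.
have h : dZ (F (xs i)) (G y) <= rho.
  have := ismetric_tri dM (F x) (F (xs i)) (G y).
  rewrite (dist_xs_F (Ordinal ik)) /=; last slra.
  rewrite (ismetric_sym dM (F x)); slra.
apply/activeP; exists (Ordinal ik); first by rewrite sigYP.
by apply/asboolP; exists y.
Qed.

Lemma close_ball_reached x y : dist X (pt X) x <= r + 1 -> dist Y (pt Y) y <= r ->
  dZ (F x) (G y) <= e -> active (sigX x).
Proof.
move=> xr yr xy; have [i ik ix] := net xr.
apply/activeP; exists (Ordinal ik); first by rewrite sigXP /=; slra.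
apply/asboolP; exists y => //=.
have := ismetric_tri dM (F x) (F (xs i)) (G y).
rewrite (dist_xs_F (Ordinal ik)) /=; slra.
Qed.

Lemma support_pt : support (pt X).
Proof.
apply: active_sigX_support; apply: (@close_ball_reached _ (pt Y)) => //.
  by rewrite ismetric_xx//; slra.
by rewrite ismetric_xx//; slra.
Qed.

Lemma active_inner_ball x : dist X (pt X) x <= r - p -> active (sigX x).
Proof.
move=> xr; have [|y yr xy] := FG.1 x; first slra.
by apply: (@close_ball_reached x y) => //; slra.
Qed.

Lemma mborel_cellX J : mborel (dist X) [set x | sigX x = J].
Proof. by apply: mborel_signature => i; exact: mborel_cball dX _ _. Qed.

Lemma mborel_ballX t A : t <= r + 3 -> mclosed dZ A ->
  mborel (dist X) (cball X t `&` F @^-1` A).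
Proof. by move=> tr cA; exact: mborel_closed (mclosed_ball_preimage dX Fi tr cA). Qed.

Lemma mborel_ballY t A : t <= r + 3 -> mclosed dZ A ->
  mborel (dist Y) (cball Y t `&` G @^-1` A).
Proof. by move=> tr cA; exact: mborel_closed (mclosed_ball_preimage dY Gi tr cA). Qed.

Lemma mborel_cellY J : mborel (dist Y) [set y | sigY y = J].
Proof.
apply: (@mborel_signature _ _ _ _
  (fun (i : 'I_k) y => (dist Y (pt Y) y <= r) && (dZ (F (xs i)) (G y) <= rho))) => i.
have := @mborel_ballY r [set z | dZ (F (xs i)) z <= rho].
rewrite lerDl => /(_ (ler0n _ 3) (mclosed_cball dM _ _)); congr mborel.
by apply/seteqP; split => y /=; [move=> [h1 h2]; apply/andP|move=> /andP].
Qed.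

Lemma mborel_N : mborel (dist X) N.
Proof.
apply: mborel_closed; apply: mclosed_bigcup_seq => i.
exact: mclosed_annulus dX _ _ _.
Qed.

Lemma mclosed_core J a : mclosed dZ (core J a).
Proof.
have := @mclosed_bigcap _ _ dZ 'I_k (fun=> True)
  (fun i z => if i \in J then dZ (F (xs i)) z <= rho - a else rho + a <= dZ (F (xs i)) z).
have h (i : 'I_k) : mclosed dZ
    (fun z => if i \in J then dZ (F (xs i)) z <= rho - a else rho + a <= dZ (F (xs i)) z).
  by case: (i \in J); [exact: mclosed_cball dM _ _|exact: mclosed_ge dM _ _].
move=> /(_ (fun i _ => h i)); congr mclosed.
by apply/seteqP; split => z hz i //; exact: hz.
Qed.

Lemma mnbhd_core J a z : mnbhd dZ (core J a) e z -> core J (a - e) z.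
Proof.
move=> hz i; case: ifPn => iJ.
  have sub : core J a `<=` [set w | dZ (F (xs i)) w <= rho - a].
    by move=> w /(_ i); rewrite iJ.
  have := mnbhd_dist_le dM sub hz; slra.
have sub : core J a `<=` [set w | rho + a <= dZ (F (xs i)) w].
  by move=> w /(_ i); rewrite (negbTE iJ).
have := mnbhd_dist_ge dM sub hz; slra.
Qed.

Lemma notin_N x (i : 'I_k) : ~ N x -> ep < `|dist X (xs i) x - rho|.
Proof.
by move=> nN; rewrite ltNge; apply/negP => h; apply: nN; exists (i : nat) => //; rewrite mem_iota /=.
Qed.

Lemma cellX_fin J : active J -> meas X [set x | sigX x = J] \is a fin_num.
Proof.
move=> /activeP[i iJ _].
apply: (meas_sub_cball_fin dX muX (fun c r => XC.2 c r) (c := pt X) (r := r + 2)).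
  exact: mborel_cellX.
by move=> x /= xJ; apply: (@near_xs_ball i); rewrite -sigXP xJ.
Qed.

Lemma cellY_fin J : active J -> meas Y [set y | sigY y = J] \is a fin_num.
Proof.
move=> /activeP[i iJ _].
apply: (meas_sub_cball_fin dY muY (fun c r => YC.2 c r) (c := pt Y) (r := r)).
  exact: mborel_cellY.
by move=> x /= xJ; apply: (@sigY_ball i); rewrite xJ.
Qed.

(** The cell maps into [core J 0], and passing to [X] costs a margin [e]. Outside [N] the distances
    differ from [rho] by more than [ep], so the signature is still [J]. *)
Lemma cellY_le J : active J ->
  (meas Y [set y | sigY y = J] <= meas X [set x | sigX x = J] + theta%:E)%E.
Proof.
move=> /activeP[i0 i0J _].
apply: (@le_trans _ _ (meas Y (cball Y r `&` G @^-1` core J 0))).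
  apply: (le_meas muY); first exact: mborel_cellY.
    by apply: mborel_ballY; [slra|exact: mclosed_core].
  move=> y /= yJ; have yr : dist Y (pt Y) y <= r by apply: (@sigY_ball i0); rewrite yJ.
  split => // i; rewrite subr0 addr0 -yJ sigYP//.
  by case: ifPn => //; rewrite -ltNge => /ltW.
have h : r + 2 * e <= r + 3 by slra.
apply: (le_trans (GF.2 r _ h (@mclosed_core J 0))).
rewrite EFinD addeA leeD2r//; apply: le_trans (leeD2l _ NE).
apply: (meas_subU muX) => //.
- exact: mborel_ballX h (mclosed_mnbhd dM _ _).
- exact: mborel_cellX.
- exact: mborel_N.
move=> x [xr /mnbhd_core hx]; have [|nN] := pselect (N x); first by right.
left; apply/setP => i; rewrite sigXP.
have := notin_N i nN; have := hx i.
rewrite dist_xs_F; last by rewrite /cball /cballc /= in xr; slra.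
case: ifPn => iJ h1; rewrite ltNge ler_distl => /negP h2.
  by apply/negPn/negP => h3; apply: h2; apply/andP; split; slra.
by apply/negP => h3; apply: h2; apply/andP; split; slra.
Qed.

(** Outside [N] the cell maps into [core J (2 * e)], and a margin [e] survives the passage to [Y],
    so the signature is [J]. A cell that meets the inner ball has diameter at most
    [2 * rho < p / 2], so it stays within [r - 2 * e] and its partners within [r]. *)
Lemma cellX_le J : active J ->
  (exists2 x, sigX x = J & dist X (pt X) x <= r - p) ->
  (meas X [set x | sigX x = J] <= meas Y [set y | sigY y = J] + theta%:E)%E.
Proof.
move=> /activeP[i0 i0J _] [x0 x0J x0r].
apply: (@le_trans _ _ (meas X (cball X (r - 2 * e) `&` F @^-1` core J (2 * e)) + eta%:E)).
  apply: le_trans (leeD2l _ NE); apply: (meas_subU muX) => //.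
  - exact: mborel_cellX.
  - by apply: mborel_ballX; [slra|exact: mclosed_core].
  - exact: mborel_N.
  move=> x /= xJ; have [|nN] := pselect (N x); first by right.
  left.
  have xr : dist X (pt X) x <= r - 2 * e.
    have h1 : dist X (xs i0) x <= rho by rewrite -sigXP xJ.
    have h2 : dist X (xs i0) x0 <= rho by rewrite -sigXP x0J.
    have := ismetric_tri dX x0 (pt X) x; have := ismetric_tri dX (xs i0) x0 x.
    rewrite (ismetric_sym dX x0 (xs i0)); slra.
  split => // i; rewrite dist_xs_F; last by slra.
  have := notin_N i nN; rewrite -xJ sigXP.
  case: ifPn => h1; rewrite ltNge ler_distl => /negP h2.
    by apply/negPn/negP => h3; apply: h2; apply/andP; split; slra.
  by apply/negPn/negP => h3; apply: h2; apply/andP; split; slra.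
have h : r - 2 * e + 2 * e <= r + 3 by slra.
have := FG.2 _ _ h (@mclosed_core J (2 * e)); rewrite subrK.
move=> /(leeD2r eta%:E) /le_trans; apply.
rewrite -addeA -EFinD (addrC e) leeD2r//.
apply: (le_meas muY).
- by apply: mborel_ballY; [slra|exact: mclosed_mnbhd dM _ _].
- exact: mborel_cellY.
move=> y [yr /mnbhd_core hy]; apply/setP => i; rewrite sigYP//.
have := hy i; case: ifPn => iJ h1; first by slra.
by apply/negP => h2; slra.
Qed.

(** Weight 1 on the cells meeting the inner ball makes the submeasure dominate that ball; the other
    two bounds match the masses of cells up to [theta]. *)
Definition good_weight (J : {set 'I_k}) (a : R) := 0 <= a <= 1 /\
  (active J -> [/\ (exists2 x, sigX x = J & dist X (pt X) x <= r - p) -> a = 1,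
    (a%:E * meas X [set x | sigX x = J] <= meas Y [set y | sigY y = J] + theta%:E)%E &
    (meas Y [set y | sigY y = J] <= a%:E * meas X [set x | sigX x = J] + theta%:E)%E]).

Lemma good_weight_exists J : exists a, good_weight J a.
Proof.
have [aJ|nJ] := boolP (active J); last first.
  by exists 0; split; rewrite ?lexx ?ler01 // (negbTE nJ).
have [||||||c [c01 h1 h2 h3]] := weight_exists
  (m := meas X [set x | sigX x = J]) (b := meas Y [set y | sigY y = J])
  (th := theta%:E) _ _ _ _ _ _ (cellY_le aJ) (cellX_le aJ).
- exact: cellX_fin.
- exact: cellY_fin.
- by [].
- exact: (meas_ge0 muX) (mborel_cellX J).
- exact: (meas_ge0 muY) (mborel_cellY J).
- by rewrite lee_fin addr_ge0// ltW.
by exists c.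
Qed.

Lemma same_cell_dist J x y : active J -> sigX x = J -> sigY y = J ->
  dZ (F x) (G y) <= p / 2.
Proof.
move=> /activeP[i iJ _] xJ yJ.
have h1 : dist X (xs i) x <= rho by rewrite -sigXP xJ.
have yr : dist Y (pt Y) y <= r by apply: (@sigY_ball i); rewrite yJ.
have h2 : dZ (F (xs i)) (G y) <= rho by rewrite -sigYP// yJ.
have := ismetric_tri dM (F (xs i)) (F x) (G y).
rewrite (ismetric_sym dM (F x) (F (xs i))) dist_xs_F; [slra|].
have := near_xs_ball h1; slra.
Qed.

Lemma sum_theta_le : (\sum_(J | active J) theta%:E <= (p / 2)%:E)%E.
Proof.
apply: (@le_trans _ _ (\sum_(J : {set 'I_k}) theta%:E)%E).
  rewrite big_mkcond; apply: lee_sum => J _; case: ifP => // _.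
  by rewrite lee_fin addr_ge0// ltW.
by rewrite sumEFin sumr_const lee_fin -[X in X <= _]mulr_natl.
Qed.

Lemma cut_exists : exists (S : set (car X)) (hS : S (pt X)) (nu : set {x | S x} -> \bar R),
  [/\ is_subpmm X S nu, compact_pmm (sub_pmm hS nu), ball_le X (r - p) S nu &
      (dGHPc (ballpmm Y r) (sub_pmm hS nu) <= (p / 2)%:E)%E].
Proof.
have [c hc] := choice good_weight_exists.
have c0 J : 0 <= c J by have [/andP[]] := hc J.
have c1 J : c J <= 1 by have [/andP[]] := hc J.
(* Each active cell carries [meas X] scaled by its weight. *)
pose nu (A : set {x | support x}) : \bar R :=
  (\sum_(J | active J) (c J)%:E * meas X ((inc support @` A) `&` [set x | sigX x = J]))%E.
have nuE A : nu (inc support @^-1` A) = (\sum_(J | active J)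
    (c J)%:E * meas X ((A `&` support) `&` [set x | sigX x = J]))%E.
  by apply: eq_bigr => J _; rewrite image_incl_preimage.
have bS : mborel (dist X) support by exact: mborel_closed mclosed_support.
have bAS A : mborel (dist X) A -> mborel (dist X) (A `&` support) by move=> ?; exact: mborelI.
have bFS A : mclosed dZ A -> mborel (dist X) (F @^-1` A `&` support).
  move=> cA; have := mborelI (mborel_ballX (lexx (r + 3)) cA) bS; congr mborel.
  apply/seteqP; split=> x; first by move=> [[_ ?] ?].
  move=> [Ax Sx]; split => //; split => //; rewrite /cball /cballc /=.
  have := support_ball Sx; slra.
have nu0 B : mborel (dist X) B -> forall J,
    (0 <= (c J)%:E * meas X (B `&` [set x | sigX x = J]))%E.
  move=> bB J; rewrite mule_ge0 ?lee_fin// (meas_ge0 muX)//.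
  by apply: mborelI => //; exact: mborel_cellX.
have subX : is_subpmm X support nu.
  split.
    apply: is_measure_sum => // J.
    exact: is_measure_restrict dX muX mclosed_support (mborel_cellX J).
  move=> A bA; rewrite nuE.
  apply: (@le_trans _ _ (\sum_(J | active J)
      meas X ((A `&` support) `&` [set x | sigX x = J]))%E).
    apply: lee_sum => J _; rewrite -[leRHS]mul1e lee_wpmul2r ?lee_fin//.
    by apply: (meas_ge0 muX); apply: mborelI; [exact: bAS|exact: mborel_cellX].
  rewrite (meas_fibers_cond muX)//; [|exact: bAS|exact: mborel_cellX].
  apply: (le_meas muX) => //; last by move=> x [[]].
  apply: mborelI; first exact: bAS.
  have := mborel_in_seq (enum active) mborel_cellX; congr mborel.
  by apply/seteqP; split=> x /=; rewrite mem_enum.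
have cpt : compact_pmm (sub_pmm support_pt nu).
  split; first exact: (mcompact_sub dX mcompact_support).
  have := subX.2 _ bS; rewrite (_ : inc support @^-1` support = setT); last first.
    by apply/seteqP; split => // -[].
  move=> /le_lt_trans; apply; rewrite -ge0_fin_numE ?(meas_ge0 muX)//.
  exact: (meas_sub_cball_fin dX muX (fun c r => XC.2 c r)) support_ball.
exists support, support_pt, nu; split => //.
- split; first by move=> x hx; apply: active_sigX_support; exact: active_inner_ball.
  move=> A bA; rewrite nuE.
  have bAB : mborel (dist X) (A `&` cball X (r - p)).
    by apply: mborelI => //; exact: mborel_ball XM _.
  (* The inner ball is covered by active cells, and those that meet it have weight 1. *)
  have -> : A `&` cball X (r - p) =
      (A `&` cball X (r - p)) `&` [set x | active (sigX x)].
    apply/seteqP; split=> x; last by case.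
    by move=> [? ?]; split => //; exact: active_inner_ball.
  rewrite -(meas_fibers_cond muX)//; last exact: mborel_cellX.
  apply: lee_sum => J aJ.
  have [mJ|nJ] := pselect (exists2 x, sigX x = J & dist X (pt X) x <= r - p).
    have [_ /(_ aJ)[/(_ mJ) -> _ _]] := hc J; rewrite mul1e.
    apply: (le_meas muX).
    + by apply: mborelI => //; exact: mborel_cellX.
    + by apply: mborelI; [exact: bAS|exact: mborel_cellX].
    + by move=> x [[Ax _] xJ]; split => //; split => //;
        apply: active_sigX_support; rewrite xJ.
  rewrite [W in meas _ W](_ : _ = set0) ?(meas0 muX) ?nu0//; first exact: bAS.
  by apply/seteqP; split=> // x [[_ xr] xJ]; apply: nJ; exists x.
apply: (@dGHPc_sub_le _ _ _ _ _ _ _ _ _ Z dZ G F) => //.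
- by slra.
- rewrite ballsetE//; last exact: ltW.
  by move=> x y hx hy; apply: Gi; rewrite /cball /cballc /= in hx hy *; slra.
- by move=> x y /support_ball hx /support_ball hy; apply: Fi; rewrite /cball /cballc /=; slra.
- by rewrite (ismetric_sym dM); move: oo; slra.
- rewrite ballsetE//; last exact: ltW.
  move=> y yr; have [|x xr yx] := GF.1 y; first by rewrite /cball /cballc /= in yr; slra.
  exists x; last by slra.
  apply: active_sigX_support; apply: (@close_ball_reached x y) => //.
    by rewrite /cball /cballc /= in yr; slra.
  by rewrite (ismetric_sym dM).
- rewrite ballsetE//; last exact: ltW.
  move=> x Sx; have /supportP[i /asboolP[y yr iy] ix] := Sx.
  exists y => //; have := ismetric_tri dM (F (xs i)) (G y) (F x).
  rewrite (ismetric_sym dM (G y) (F (xs i))) dist_xs_F; first slra.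
  by have := support_ball Sx; slra.
- move=> A cA; rewrite nuE image_incl_preimage ballsetE//; last exact: ltW.
  rewrite [_ `&` cball _ _]setIC.
  have cN := mclosed_mnbhd dM A (p / 2).
  have rr : r <= r + 3 by slra.
  have bB := mborel_ballY rr cA.
  have -> : cball Y r `&` G @^-1` A =
      (cball Y r `&` G @^-1` A) `&` [set y | active (sigY y)].
    apply/seteqP; split=> y; last by case.
    by move=> [? ?]; split => //; exact: active_sigY.
  rewrite -(meas_fibers_cond muY)//; last exact: mborel_cellY.
  apply: le_trans (leeD2l _ sum_theta_le); rewrite -big_split /=.
  apply: lee_sum => J aJ.
  (* If the cell of [Y] meets the set, the whole cell of [X] lies in the neighbourhood, since points
     of equal signature are at most [p / 2] apart. So whole cells are compared, at a cost [theta]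
     each. *)
  have [[y [[yr Ay] yJ]]|nJ] := pselect (exists y,
      ((cball Y r `&` G @^-1` A) `&` [set y | sigY y = J]) y); last first.
    rewrite [W in meas _ W](_ : _ = set0) ?(meas0 muY); last first.
      by apply/seteqP; split=> // y hy; apply: nJ; exists y.
    rewrite adde_ge0 ?lee_fin ?nu0//; first exact: bFS.
    by rewrite addr_ge0// ltW.
  apply: (@le_trans _ _ (meas Y [set y | sigY y = J])).
    apply: (le_meas muY); [|exact: mborel_cellY|by move=> ? []].
    by apply: mborelI => //; exact: mborel_cellY.
  have [_ /(_ aJ)[_ _ /le_trans]] := hc J; apply.
  rewrite leeD2r// lee_wpmul2l ?lee_fin//; apply: (le_meas muX).
  + exact: mborel_cellX.
  + by apply: mborelI; [exact: bFS|exact: mborel_cellX].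
  + move=> x xJ; split => //; split; last by apply: active_sigX_support; rewrite xJ.
    by apply: (@in_mnbhd _ _ _ A _ (F x) (G y)) => //; exact: (same_cell_dist aJ).
- move=> A cA; rewrite nuE image_incl_preimage ballsetE//; last exact: ltW.
  rewrite [X in (_ <= meas Y X + _)%E]setIC.
  have cN := mclosed_mnbhd dM A (p / 2).
  have rr : r <= r + 3 by slra.
  have bB := mborel_ballY rr cN.
  apply: (@le_trans _ _ (\sum_(J | active J) meas Y ((cball Y r `&`
      G @^-1` mnbhd dZ A (p / 2)) `&` [set y | sigY y = J]) + (p / 2)%:E)%E); last first.
    rewrite leeD2r// (meas_fibers_cond muY)//; last exact: mborel_cellY.
    apply: (le_meas muY) => //.
    apply: mborelI => //.
    have := mborel_in_seq (enum active) mborel_cellY; congr mborel.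
    by apply/seteqP; split=> x /=; rewrite mem_enum.
  apply: le_trans (leeD2l _ sum_theta_le); rewrite -big_split /=.
  apply: lee_sum => J aJ.
  have [[x [[Ax Sx] xJ]]|nJ] := pselect (exists x,
      ((F @^-1` A `&` support) `&` [set x | sigX x = J]) x); last first.
    rewrite [W in meas _ W](_ : _ = set0) ?(meas0 muX) ?mule0; last first.
      by apply/seteqP; split=> // x hx; apply: nJ; exists x.
    rewrite adde_ge0 ?lee_fin ?(meas_ge0 muY)//.
      by apply: mborelI => //; exact: mborel_cellY.
    by rewrite addr_ge0// ltW.
  apply: (@le_trans _ _ ((c J)%:E * meas X [set x | sigX x = J])%E).
    rewrite lee_wpmul2l ?lee_fin//; apply: (le_meas muX).
    + by apply: mborelI; [exact: bFS|exact: mborel_cellX].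
    + exact: mborel_cellX.
    + by move=> ? [].
  have [_ /(_ aJ)[_ /le_trans + _]] := hc J; apply.
  rewrite leeD2r//; apply: (le_meas muY).
  + exact: mborel_cellY.
  + by apply: mborelI => //; exact: mborel_cellY.
  + move=> y yJ; split => //.
    have /activeP[i iJ _] := aJ.
    split; first by apply: (@sigY_ball i); rewrite yJ.
    apply: (@in_mnbhd _ _ _ A _ (G y) (F x)) => //.
    by rewrite (ismetric_sym dM); exact: (same_cell_dist aJ).
Qed.

End Cells.

(** The constants are fixed in this order, none depending on [Y]: [p], the net, [rho] off the
    countably many heavy radii, [eta] small against the number of cells, [ep] from the mass of the
    annuli, and [e]. *)
Lemma bridge_cut (R : realType) (X : pmm R) (r eps : R) :
  is_pmm X -> bcompact X -> 0 < r -> 0 < eps ->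
  exists s e : R, [/\ 0 < s, 0 < e & forall Y, is_pmm Y -> bcompact Y ->
    bridge X Y s e ->
    exists (S : set (car X)) (hS : S (pt X)) (nu : set {x | S x} -> \bar R),
    [/\ is_subpmm X S nu, compact_pmm (sub_pmm hS nu), ball_le X (r - eps) S nu &
        (dGHPc (ballpmm Y r) (sub_pmm hS nu) < eps%:E)%E]].
Proof.
move=> XM XC r0 eps0; have [dX muX] := XM.
pose p := Num.min eps 1.
have p0 : 0 < p by rewrite lt_min eps0 ltr01.
have p1 : p <= 1 by rewrite ge_min lexx orbT.
have peps : p <= eps by rewrite ge_min lexx.
have p8 : 0 < p / 8 by lra.
have o1 : cball X (r + 1) (pt X) by rewrite /cball /cballc /= ismetric_xx//; lra.
have [k [xs [xsr net]]] := mcompact_net dX (XC.1 (pt X) (r + 1)) o1 p8.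
have muf c t := XC.2 c t.
have cH : countable (\bigcup_i [set t | meas X [set x | dist X (xs i) x = t] != 0%E]).
  by apply: bigcup_countable => // i _; exact: (countable_heavy_spheres dX muX).
have [rho /andP[rho8 rho4] rhoN] : exists2 rho, p / 8 < rho < p / 4 &
    ~ (\bigcup_i [set t | meas X [set x | dist X (xs i) x = t] != 0%E]) rho.
  by apply: exists_notin_countable => //; lra.
pose K : R := #|{set 'I_k}|%:R.
have K0 : 0 <= K by rewrite ler0n.
have [eta eta0 Keta] : exists2 eta, 0 < eta & K * (eta + eta) <= p / 2.
  exists (p / (4 * (K + 1))); first by rewrite divr_gt0// mulr_gt0//; lra.
  have q0 : 0 < 4 * (K + 1) by lra.
  rewrite -mulrDl mulrA ler_pdivrMr//.
  have : 0 <= p by lra.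
  nra.
have [ep ep0 NE] : exists2 ep, 0 < ep & (meas X [set y | (exists2 i, (i \in iota 0 k) &
    `|dist X (xs i) y - rho| <= ep)%R] <= eta%:E)%E.
  apply: (meas_annuli_small dX muX) => // i _; apply/eqP/negPn/negP => h.
  by apply: rhoN; exists i.
have [e [e0 h1 h2] [h3 h4]] : exists2 e, [/\ 0 < e, 2 * e <= ep & e <= rho - p / 8]
    & 4 * e <= p /\ e <= eta.
  (* The default value at index 3 gives [4 * e <= eta]. *)
  have [||e e0 he] := @finite_pos_witness R 4
      (fun i e => 4 * e <= nth eta [:: ep; rho - p / 8; p] i).
  - by move=> i e e' ee'; apply: le_trans; rewrite ler_pM2l.
  - move=> i _; have : 0 < nth eta [:: ep; rho - p / 8; p] i.
      by case: i => [|[|[|[|i]]]] //=; rewrite ?subr_gt0.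
    by move: (nth _ _ _) => q q0; exists (q / 4); lra.
  have := he 0%N isT; have := he 1%N isT; have := he 2%N isT; have := he 3%N isT => /=.
  by move=> ? ? ? ?; exists e; split; lra.
exists (r + 3), e; split => //; first lra.
move=> Y YM YC [Z [dZ [F [G [dM [Fi Gi] [_ oo] FG GF]]]]].
have Keta' : K * (eta + e) <= p / 2.
  by apply: le_trans Keta; rewrite ler_wpM2l// lerD2l.
have [S [hS [nu [sub cpt le lt]]]] := @cut_exists R X Y r p rho eta ep e k xs Z dZ F G
  XM XC YM YC r0 p0 p1 rho8 rho4 e0 h1 h2 h3 (ltW eta0) xsr net NE Keta' dM Fi Gi oo FG GF.
exists S, hS, nu; split => //.
  split; first by move=> x hx; apply: le.1; apply: (le_trans hx); lra.
  move=> A bA; apply: le_trans (le.2 A bA); apply: (le_meas muX).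
  - by apply: mborelI => //; exact: mborel_ball XM _.
  - by apply: mborelI => //; exact: mborel_ball XM _.
  - by move=> x [Ax hx]; split => //; apply: (le_trans hx); lra.
by apply: (le_lt_trans lt); rewrite lte_fin; lra.
Qed.

(** * The implications *)

Lemma cvge0_near_lt (R : realType) (u : nat -> \bar R) (e : R) :
  u n @[n --> \oo] --> 0%E -> 0 < e -> \forall n \near \oo, (u n < e%:E)%E.
Proof.
move=> cu e0; apply: (cu [set x | (x < e%:E)%E]); apply: open_nbhs_nbhs.
by split; [exact: open_ereal_lt_ereal|rewrite /= lte_fin].
Qed.

Lemma cvge0_near_le (R : realType) (u : nat -> \bar R) :
  (forall n, (0 <= u n)%E) ->
  (forall e : R, 0 < e -> \forall n \near \oo, (u n <= e%:E)%E) ->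
  u n @[n --> \oo] --> 0%E.
Proof.
move=> u0 h; apply/fine_cvgP; split.
  have := h 1 ltr01; apply: filterS => n un1.
  by rewrite ge0_fin_numE// (le_lt_trans un1)// ltry.
apply/cvgrPdist_le => e e0; have := h e e0; apply: filterS => n /= une.
have fin : u n \is a fin_num by rewrite ge0_fin_numE// (le_lt_trans une)// ltry.
by rewrite sub0r normrN ger0_norm ?fine_ge0// -lee_fin fineK.
Qed.

(** * Integrals of nonnegative functions that need not be measurable *)

Section LowerIntegral.
Context (d : measure_display) (T : measurableType d) (R : realType)
  (mu : {measure set T -> \bar R}).
Import HBNNSimple.

(* Since the integral of a nonnegative function is a supremum over simple
   functions, this holds without measurability. *)
Lemma le_lower_integral (D : set T) (f g : T -> \bar R) :
  (forall x, D x -> (0 <= f x)%E) -> (forall x, D x -> (f x <= g x)%E) ->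
  (\int[mu]_(x in D) f x <= \int[mu]_(x in D) g x)%E.
Proof.
move=> f0 fg; rewrite !ge0_integralE//; last first.
  by move=> x Dx; exact: le_trans (f0 x Dx) (fg x Dx).
apply: ereal_sup_le => _ [h hf <-]; exists h => //= x.
apply: (le_trans (hf x)); rewrite /patch; case: ifPn => //.
by rewrite inE; exact: fg.
Qed.

(** Each [f n] is replaced by a simple function [h n] below it whose integral is at most [1/(n+1)]
    smaller. The [h n] are measurable, so dominated convergence applies to them. *)
Lemma lower_integral_cvg0 (D : set T) (f : nat -> T -> \bar R) (g : T -> \bar R) :
  mu.-integrable setT g -> (forall x, (0 <= g x)%E) ->
  (forall n x, D x -> (0 <= f n x)%E) -> (forall n x, D x -> (f n x <= g x)%E) ->
  {ae mu, forall x, D x -> f n x @[n --> \oo] --> 0%E} ->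
  (\int[mu]_(x in D) f n x)%E @[n --> \oo] --> 0%E.
Proof.
move=> ig g0 f0 fg fcv.
(* Finiteness makes the integral strictly larger than itself minus [1/(n+1)], which yields [h n]. *)
have fin n : (\int[mu]_(x in D) f n x)%E \is a fin_num.
  rewrite ge0_fin_numE; last by apply: integral_ge0; exact: f0.
  apply: (@le_lt_trans _ _ (\int[mu]_x g x)%E); last first.
    have /integrableP[_] := ig.
    by under eq_integral do rewrite gee0_abs//.
  rewrite integral_mkcond; apply: le_lower_integral => x _; rewrite /patch.
    by case: ifPn => //; rewrite inE; exact: f0.
  by case: ifPn => //; rewrite inE; exact: fg.
have /choice[h hh] : forall n, exists h : {nnsfun T >-> R},
    (forall x, ((h x)%:E <= (f n \_ D) x)%E) /\
    (\int[mu]_(x in D) f n x <= \int[mu]_x (h x)%:E + (n.+1%:R^-1)%:E)%E.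
  move=> n.
  have : ((\int[mu]_(x in D) f n x - (n.+1%:R^-1)%:E)%E < \int[mu]_(x in D) f n x)%E.
    by rewrite lteBlDr// lteDl// lte_fin invr_gt0.
  rewrite [X in (_ < X)%E]ge0_integralE//; last exact: f0.
  move=> /ereal_sup_gt[_ [h hf <-]] lt; exists h; split => //.
  by rewrite integralT_nnsfun -leeBlDr//; exact: ltW.
have hg n x : ((h n x)%:E <= g x)%E.
  have [hf _] := hh n; apply: (le_trans (hf x)); rewrite /patch; case: ifPn => //.
  by rewrite inE; exact: fg.
have := @dominated_convergence _ _ _ mu setT measurableT (fun n x => (h n x)%:E) (cst 0%E) g.
case.
- by move=> n; exact/measurable_EFinP.
- exact: measurable_cst.
- move: fcv; apply: filterS => x fx _.
  have [Dx|nDx] := pselect (D x).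
    apply: (@squeeze_cvge _ _ _ _ (cst 0%E) _ (fun n => f n x)).
    + apply: nearW => n; rewrite lee_fin fun_ge0 /=.
      by have [/(_ x)] := hh n; rewrite /patch mem_set.
    + exact: cvg_cst.
    + exact: fx.
  rewrite (_ : (fun n => _) = cst 0%E); first exact: cvg_cst.
  apply/funext => n; apply/eqP; rewrite eq_le; apply/andP; split; last by rewrite lee_fin fun_ge0.
  by have [/(_ x)] := hh n; rewrite /patch memNset.
- exact: ig.
- by apply: aeW => x n _; rewrite gee0_abs ?lee_fin ?fun_ge0.
move=> _ _; rewrite integral0 => cv.
apply: (@squeeze_cvge _ _ _ _ (cst 0%E) _
    (fun n => \int[mu]_x (h n x)%:E + (n.+1%:R^-1)%:E)%E).
- apply: nearW => n; rewrite integral_ge0/=; last exact: f0.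
  by have [_] := hh n.
- exact: cvg_cst.
- rewrite -[0%E]adde0; apply: cvgeD => //.
  exact: cvge_harmonic.
Qed.

End LowerIntegral.

Section Implications.
Context (R : realType).
Implicit Types X Y : pmm R.

Lemma ball_le_weaken X (s t : R) S nu : is_pmm X -> t <= s ->
  ball_le X s S nu -> ball_le X t S nu.
Proof.
move=> XM ts [sS le]; split; first by move=> x hx; apply: sS; exact: le_trans ts.
move=> A bA; apply: le_trans (le A bA); apply: (le_meas XM.2).
- by apply: mborelI => //; exact: mborel_ball XM _.
- by apply: mborelI => //; exact: mborel_ball XM _.
- by move=> x [Ax hx]; split => //; exact: le_trans ts.
Qed.

Lemma dGHP_ge0 X Y : (0 <= dGHP X Y)%E.
Proof.
apply: le_ereal_inf_tmp => _ [[e [/andP[e0 _] _] <-]|->]; first by rewrite lee_fin ltW.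
exact: lee01.
Qed.

Lemma acoef_ball_le X Y (a q : R) : is_pmm Y -> bcompact Y -> 0 <= q -> 0 <= a ->
  (acoef a q X Y <= dGHPc (ballpmm X q) (ballpmm Y q))%E.
Proof.
move=> YM YC q0 a0; apply: ge_ereal_inf.
exists (dGHPc (ballpmm X q) (ballpmm Y q)) => //.
exists (ballset Y q), (or_introl erefl), (fun A => meas Y (inc (ballset Y q) @` A)).
split => //.
- exact: ball_is_subpmm.
- exact: ball_compact_pmm.
- by apply: ball_ball_le => //; lra.
Qed.

End Implications.

(** * The conditions for a fixed limit and a fixed sequence *)

Section Equivalence.
Context (R : realType) (X : pmm R) (Xs : nat -> pmm R).
Hypotheses (XM : is_pmm X) (XC : bcompact X)
  (XsM : forall n, is_pmm (Xs n)) (XsC : forall n, bcompact (Xs n)).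

Definition sub_approx (n : nat) (r eps : R) :=
  exists (S : set (car X)) (hS : S (pt X)) (nu : set {x | S x} -> \bar R)
    (Sn : set (car (Xs n))) (hSn : Sn (pt (Xs n))) (nun : set {x | Sn x} -> \bar R),
  [/\ [/\ is_subpmm X S nu, compact_pmm (sub_pmm hS nu) & ball_le X r S nu],
      [/\ is_subpmm (Xs n) Sn nun, compact_pmm (sub_pmm hSn nun) & ball_le (Xs n) r Sn nun] &
      (dGHPc (sub_pmm hS nu) (sub_pmm hSn nun) < eps%:E)%E].

Definition all_sub_approx := forall r eps : R, 0 < r -> 0 < eps ->
  \forall n \near \oo, sub_approx n r eps.

Definition ball_cvg (r : R) :=
  dGHPc (ballpmm (Xs n) r) (ballpmm X r) @[n --> \oo] --> 0%E.

(** The radii [s] and [t] are separate because in (i) and (ii) the subspace of [X] is only known to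
    contain a ball smaller than that of [Xs n]. *)
Lemma sub_approx_of_sub n (s t r eps : R) S hS nu : 0 <= s -> r <= s -> r <= t ->
  is_subpmm X S nu -> compact_pmm (@sub_pmm R X S hS nu) -> ball_le X t S nu ->
  (dGHPc (ballpmm (Xs n) s) (sub_pmm hS nu) < eps%:E)%E -> sub_approx n r eps.
Proof.
move=> s0 rs rt sub cpt le lt; exists S, hS, nu.
exists (ballset (Xs n) s), (or_introl erefl),
  (fun A => meas (Xs n) (inc (ballset (Xs n) s) @` A)).
split.
- by split => //; exact: ball_le_weaken le.
- by split; [exact: ball_is_subpmm|exact: ball_compact_pmm|exact: ball_ball_le].
- by rewrite dGHPcC.
Qed.

Lemma sub_approx_of_ball n (s r eps : R) : 0 <= s -> r <= s ->
  (dGHPc (ballpmm (Xs n) s) (ballpmm X s) < eps%:E)%E -> sub_approx n r eps.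
Proof.
move=> s0 rs; apply: (@sub_approx_of_sub n s s) => //.
- exact: ball_is_subpmm.
- exact: ball_compact_pmm.
- exact: ball_ball_le.
Qed.

Lemma sub_approx_bridge s e : all_sub_approx -> 0 < s -> 0 < e ->
  \forall n \near \oo, bridge X (Xs n) s e.
Proof.
move=> h s0 e0; have := h s e s0 e0; apply: filterS => n.
move=> [S [hS [nu [Sn [hSn [nun [[sub _ le] [subn _ len] lt]]]]]]].
exact: bridge_of_dGHPc lt.
Qed.

Lemma dGHP_cvg_sub_approx : dGHP (Xs n) X @[n --> \oo] --> 0%E -> all_sub_approx.
Proof.
move=> cv r eps r0 eps0.
(* For [e < de] one has [e^-1 >= r + 1] and [e <= 1], hence [e^-1 - e >= r]. *)
have [de de0 [d1 d2 d3]] : exists2 de : R, 0 < de & [/\ de <= 1, de <= eps & de * (r + 1) <= 1].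
  have r1 : 0 < r + 1 by lra.
  exists (Num.min (Num.min 1 eps) (r + 1)^-1).
    by rewrite !lt_min ltr01 eps0 invr_gt0.
  split; rewrite ?ge_min ?lexx ?orbT//.
  by rewrite -ler_pdivlMr// div1r ge_min lexx orbT.
have := cvge0_near_lt cv de0; apply: filterS => n /ereal_inf_lt[v []]; last by move=> ->; rewrite lte_fin; lra.
move=> [e [/andP[e0 e1]]]; rewrite gt_max => /andP[+ _] <-.
rewrite lte_fin => /ereal_inf_lt[w [S [hS [nu [sub cpt le ->]]]]] lt ede.
have re : r + 1 <= e^-1.
  rewrite -[leRHS]mul1r ler_pdivlMr//.
  have : e * (r + 1) <= de * (r + 1) by rewrite ler_wpM2r//; lra.
  by rewrite mulrC; lra.
apply: (@sub_approx_of_sub n e^-1 (e^-1 - e) r eps S hS nu) => //; [lra..|].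
by apply: (lt_le_trans lt); rewrite lee_fin; lra.
Qed.

Lemma sub_approx_ball_cvg r : all_sub_approx -> continuity_radius X r -> ball_cvg r.
Proof.
move=> h cr; apply: cvge0_near_le => [n|e0 e00]; first exact: dGHPc_ge0.
have [s [e [s0 ep hY]]] := bridge_ball_close XM XC cr e00.
have := sub_approx_bridge h s0 ep; apply: filterS => n; exact: hY.
Qed.

Lemma ball_cvg_dGHP : (forall r, continuity_radius X r -> ball_cvg r) ->
  dGHP (Xs n) X @[n --> \oo] --> 0%E.
Proof.
move=> h; apply: cvge0_near_le => [n|e0 e00]; first exact: dGHP_ge0.
(* A continuity radius [q > a] has [q^-1 <= 1] and [q^-1 < e0], and [q^-1] is admissible in [dGHP]
   once the balls of radius [q] are closer than [q^-1 / 2]. *)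
pose a := Num.max 1 e0^-1.
have a1 : 1 <= a by rewrite le_max lexx.
have ae : e0^-1 <= a by rewrite le_max lexx orbT.
have [||q /andP[aq _] cq] := exists_continuity_radius XM XC (a := a) (b := a + 1); [lra..|].
have q0 : 0 < q by lra.
have qi0 : 0 < q^-1 by rewrite invr_gt0.
have qi2 : 0 < q^-1 / 2 by lra.
have := cvge0_near_lt (h q cq) qi2; apply: filterS => n lt.
apply: ge_ereal_inf; exists (q^-1)%:E; last first.
  rewrite lee_fin -[e0]invrK lef_pV2 ?posrE ?invr_gt0//; lra.
left; exists q^-1 => //; split.
  by rewrite qi0 invf_le1//; lra.
rewrite gt_max /aeps invrK; apply/andP; split; apply: le_lt_trans lt.
  by apply: acoef_ball_le => //; exact: ltW.
by rewrite dGHPcC; apply: acoef_ball_le => //; exact: ltW.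
Qed.

Lemma ball_cvg_integral : (forall r, continuity_radius X r -> ball_cvg r) ->
  (\int[lebesgue_measure]_(r in [set r : R | (0 <= r)%R])
     ((expR (- r)%R)%:E * mine 1%E (dGHPc (ballpmm (Xs n) r) (ballpmm X r))))%E
  @[n --> \oo] --> 0%E.
Proof.
move=> h.
have m0 n r : (0 <= mine 1%E (dGHPc (ballpmm (Xs n) r) (ballpmm X r)))%E.
  by rewrite le_min lee01 dGHPc_ge0.
(* The dominating function is the exponential density, equal to [expR (- r)] for [r >= 0]. *)
apply: (@lower_integral_cvg0 _ _ _ lebesgue_measure _ (fun n r =>
  ((expR (- r))%:E * mine 1%E (dGHPc (ballpmm (Xs n) r) (ballpmm X r)))%E)
  (EFin \o exponential_pdf 1)).
- exact: integrable_exponential_pdf.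
- by move=> r; rewrite lee_fin exponential_pdf_ge0.
- by move=> n r _; rewrite mule_ge0 ?lee_fin ?expR_ge0.
- move=> n r r0; rewrite /= exponential_pdfE// mul1r mulN1r.
  by rewrite -[leRHS]mule1 lee_wpmul2l ?lee_fin ?expR_ge0// ge_min lexx.
(* The radius 0 joins the exceptional set, since continuity radii are positive. *)
have null : lebesgue_measure.-negligible
    ([set 0] `|` [set r | 0 < r /\ ~ continuity_radius X r]).
  apply: negligibleU.
    exists [set 0]; split => //; exact: lebesgue_measure_set1.
  have cc := countable_not_continuity_radius XM XC.
  exists [set r | 0 < r /\ ~ continuity_radius X r]; split => //.
    exact: countable_measurable.
  exact: countable_lebesgue_measure0.
apply: negligibleS null => r /= /not_implyP[r0 nr].
have [->|rn] := eqVneq r 0; first by left.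
right; split; first by rewrite lt_neqAle eq_sym rn.
move=> cr; apply: nr.
rewrite -(mule0 (expR (- r))%:E); apply: cvgeZl => //.
apply: cvge0_near_le => // e e0.
have := cvge0_near_lt (h r cr) e0; apply: filterS => n /ltW lt.
by apply: le_trans lt; rewrite ge_min lexx orbT.
Qed.

Lemma integral_sub_approx :
  (\int[lebesgue_measure]_(r in [set r : R | (0 <= r)%R])
     ((expR (- r)%R)%:E * mine 1%E (dGHPc (ballpmm (Xs n) r) (ballpmm X r))))%E
  @[n --> \oo] --> 0%E -> all_sub_approx.
Proof.
move=> cv r eps r0 eps0.
(* If all balls with radius in [[r, r + 1]] were at distance at least [eps], the integrand would be
   at least [c] on this interval of length 1. *)
pose c := expR (- (r + 1)) * Num.min 1 eps.
have c0 : 0 < c by rewrite mulr_gt0 ?expR_gt0// lt_min ltr01.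
have := cvge0_near_lt cv c0; apply: filterS => n lt.
(* The radius [s] may vary with [n]: (iii) only asks for subspaces containing the balls of radius
   [r]. *)
have [s /andP[rs sr] ds] : exists2 s, r <= s <= r + 1 &
    (dGHPc (ballpmm (Xs n) s) (ballpmm X s) < eps%:E)%E.
  apply: contrapT => nex; move: lt; apply/negP; rewrite -leNgt.
  have far s : r <= s <= r + 1 -> (eps%:E <= dGHPc (ballpmm (Xs n) s) (ballpmm X s))%E.
    by move=> hs; rewrite leNgt; apply/negP => lt; apply: nex; exists s.
  pose g : R -> \bar R := cst c%:E \_ `[r, r + 1]%classic.
  apply: (@le_trans _ _ (\int[lebesgue_measure]_(s in [set s : R | (0 <= s)%R]) g s)%E).
    rewrite /g -integral_mkcondr integral_cst /=; last first.
      by apply: measurableI => //; rewrite (_ : [set s : R | _] = `[0, +oo[%classic) //;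
        apply/seteqP; split => s /=; rewrite in_itv /= andbT.
    rewrite (_ : _ `&` _ = `[r, r + 1]%classic); last first.
      apply/seteqP; split => s /=; first by case.
      by move=> hs; split => //; move: hs; rewrite in_itv /= => /andP[? _]; lra.
    rewrite lebesgue_measure_itv /= lte_fin ltrDl ltr01 -EFinD addrAC subrr add0r.
    by rewrite mule1.
  apply: le_lower_integral => s s0; rewrite /g /patch.
    by case: ifPn => // _; rewrite lee_fin ltW.
  case: ifPn => [|_]; last by rewrite mule_ge0 ?lee_fin ?expR_ge0// le_min lee01 dGHPc_ge0.
  rewrite inE /= in_itv /= => hs; rewrite EFinM; apply: lee_pmul.
  - by rewrite lee_fin expR_ge0.
  - by rewrite lee_fin le_min ler01 ltW.
  - by rewrite lee_fin ler_expR lerN2; case/andP: hs.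
  - rewrite EFin_min; apply: le_min2 => //.
    exact: far.
by apply: (sub_approx_of_ball _ _ ds) => //; lra.
Qed.

End Equivalence.

Theorem theorem3p24 (R : realType) (X : pmm R) (Xs : nat -> pmm R) :
  is_pmm X -> bcompact X ->
  (forall n, is_pmm (Xs n)) -> (forall n, bcompact (Xs n)) ->
  [<->
   (* (i) *)
   dGHP (Xs n) X @[n --> \oo] --> 0%E;
   (* (ii) *)
   (forall r eps : R, 0 < r -> 0 < eps ->
     \forall n \near \oo, exists (S : set (car X)) (hS : S (pt X))
        (nu : set {x | S x} -> \bar R),
       [/\ is_subpmm X S nu, compact_pmm (sub_pmm hS nu), ball_le X (r - eps) S nu &
           (dGHPc (ballpmm (Xs n) r) (sub_pmm hS nu) < eps%:E)%E]);
   (* (iii) *)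
   (forall r eps : R, 0 < r -> 0 < eps ->
     \forall n \near \oo,
       exists (S : set (car X)) (hS : S (pt X)) (nu : set {x | S x} -> \bar R)
              (Sn : set (car (Xs n))) (hSn : Sn (pt (Xs n)))
              (nun : set {x | Sn x} -> \bar R),
       [/\ [/\ is_subpmm X S nu, compact_pmm (sub_pmm hS nu) & ball_le X r S nu],
           [/\ is_subpmm (Xs n) Sn nun, compact_pmm (sub_pmm hSn nun) &
                ball_le (Xs n) r Sn nun] &
           (dGHPc (sub_pmm hS nu) (sub_pmm hSn nun) < eps%:E)%E]);
   (* (iv) *)
   (forall r : R, continuity_radius X r ->
     dGHPc (ballpmm (Xs n) r) (ballpmm X r) @[n --> \oo] --> 0%E);
   (* (v) *)
   (exists I : set R, I `<=` [set r | 0 <= r] /\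
     (forall M : R, exists2 r, I r & M < r) /\
     (forall r, I r -> dGHPc (ballpmm (Xs n) r) (ballpmm X r) @[n --> \oo] --> 0%E));
   (* (vi) *)
   ((\int[lebesgue_measure]_(r in [set r : R | (0 <= r)%R])
        ((expR (- r)%R)%:E * mine 1%E (dGHPc (ballpmm (Xs n) r) (ballpmm X r)))))%E
      @[n --> \oo] --> 0%E
  ].
Proof.
move=> XM XC XsM XsC.
have approx_cvg := @sub_approx_ball_cvg R X Xs XM XC XsM XsC.
tfae.
(* The cycle follows the order of the list, but (i), (v) and (vi) are each turned into (iii)
   first. *)
- move=> /(dGHP_cvg_sub_approx XM XsM XsC) h r eps r0 eps0.
  have [s [e [s0 e0 hY]]] := bridge_cut XM XC r0 eps0.
  by have := sub_approx_bridge XM XsM h s0 e0; apply: filterS => n; exact: hY.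
(* (ii) is used at radius [r + eps], for which the inner ball has radius [r]. *)
- move=> h r eps r0 eps0.
  have r1 : 0 < r + eps by lra.
  have := h (r + eps) eps r1 eps0; apply: filterS => n [S [hS [nu [sub cpt le lt]]]].
  by apply: (sub_approx_of_sub XM XsM XsC _ _ _ sub cpt le lt); lra.
- by move=> h r; exact: approx_cvg.
- move=> h; exists [set r | continuity_radius X r]; split; first by move=> r [/ltW].
  split=> // M.
  have [||r /andP[Mr _] cr] := exists_continuity_radius XM XC
    (a := Num.max 0 M) (b := Num.max 0 M + 1).
  + by rewrite le_max lexx.
  + by rewrite ltrDl ltr01.
  by exists r => //; apply: le_lt_trans Mr; rewrite le_max lexx orbT.
- move=> [I [I0 [Iu Ic]]].
  have h : all_sub_approx X Xs.
    move=> r eps r0 eps0; have [s Is rs] := Iu r.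
    have := cvge0_near_lt (Ic s Is) eps0; apply: filterS => n lt.
    by apply: (sub_approx_of_ball XM XC XsM XsC _ _ lt); [exact: I0|exact: ltW].
  by apply: ball_cvg_integral => // r; exact: approx_cvg.
- move=> /(integral_sub_approx XM XC XsM XsC) h.
  by apply: ball_cvg_dGHP => // r; exact: approx_cvg.
Qed.
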